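(* Consider either the dilute $A_4$ model (with $\mathfrak g=E_7$, $a_{\max}=7$) or the dilute $A_6$ model (with $\mathfrak g=E_6$, $a_{\max}=6$), in the setting described in the context. Then the functions $Y^{(a)}$ defined in the context satisfy, as identities of meromorphic functions of $x$, $$Y^{(a)}(x-i)\,Y^{(a)}(x+i)=\prod_{b\sim a}\big(1+Y^{(b)}(x)\big),\qquad a=1,\dots,a_{\max},$$ where $b\sim a$ means that $a$ and $b$ are adjacent nodes of the Dynkin diagram of $\mathfrak g$.
   Context: Dynkin labelling. $E_7$: chain $1-2-3-4-5-6$ with node $7$ attached to node $3$. $E_6$: chain $1-2-3-4-5$ with node $6$ attached to node $3$. Convention: $f(x\pm iy):=f(x+iy)f(x-iy)$. Basic functions. For $L\in\{4,6\}$ put $\eta=\frac{\pi(L+2)}{4(L+1)}$ (so $\eta=\frac{3\pi}{10}$ for $L=4$, $\eta=\frac{2\pi}7$ for $L=6$), fix $\tau>0$, $q=e^{-\tau}$, $\vartheta_1(z)=2q^{1/4}\sin z\prod_{n\ge1}(1-2q^{2n}\cos 2z+q^{4n})(1-q^{2n})$, $h[x]=\vartheta_1(i\eta x)$. Let $N$ be a positive even integer, $u$ a real parameter, $w=e^{i\pi/(L+1)}$, $$\phi(x)=\Big(\frac{h[x+(\frac32-u)i]\,h[x-(\frac32-u)i]}{h[2i]\,h[3i]}\Big)^{N/2},\qquad Q(x)=\prod_{j=1}^N h[x-x_j].$$ Both have period $\frac{10}{3}i$ ($L=4$), resp. $\frac72 i$ ($L=6$). The complex numbers $x_1,\dots,x_N$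 solve $w\frac{\phi(x_j+i)}{\phi(x_j-i)}=-\frac{Q(x_j-i)Q(x_j+2i)}{Q(x_j+i)Q(x_j-2i)}$, $j=1,\dots,N$. Boxes: $b_1(x)=w\,\phi(x+\frac32 i)\phi(x+\frac12 i)\frac{Q(x-\frac52 i)}{Q(x-\frac12 i)}$, $b_2(x)=\phi(x+\frac32 i)\phi(x-\frac32 i)\frac{Q(x-\frac32 i)Q(x+\frac32 i)}{Q(x-\frac12 i)Q(x+\frac12 i)}$, $b_3(x)=w^{-1}\phi(x-\frac32 i)\phi(x-\frac12 i)\frac{Q(x+\frac52 i)}{Q(x+\frac12 i)}$. One-row functions: for $m\ge1$, $f_m(x)=\prod_{j=1}^{m-1}\phi(x\pm i(\frac{2m-1}{2}-j))$ and $$T_m(x)=\frac1{f_m(x)}\sum_{1\le i_1\le\cdots\le i_m\le3}\ \prod_{k=1}^m b_{i_k}\big(x+i(2k-1-m)\big);$$ $T_0(x)=\phi(x\pm\frac12 i)$ and $T_m=0$ for $m<0$. Standing assumptions (largest-eigenvalue sector): $Q(x)=\overline{Q(\bar x)}$, and: for $L=4$, $T_m=T_{7-m}$ ($0\le m\le7$), $T_8=T_9=0$, $T_{m+10}=T_m$ ($m\ge-1$); for $L=6$, $T_m=T_{11-m}$ ($0\le m\le11$), $T_{12}=T_{13}=0$, $T_{m+14}=T_m$ ($m\ge-1$). Case $L=4$. For partitions $\lambda\subset\mu$ ($\mu_1'$ = number of rows of $\mu$), $\Lambda_{\mu/\lambda}(x)=\det_{1\le j,k\le\mu'_1}\big(T^{\flat}_{\mu_j-\lambda_k-j+k}(x+i(\mu'_1-\mu_1+\mu_j+\lambda_k-j-k+1))\big)$,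 where $T^\flat_m=T_m$ for $0\le m\le7$ and $T^\flat_m=0$ otherwise. Set $T^{(1)}(x)=T_1(x)$; $T^{(2)}(x)=\frac{1}{\phi(x-\frac53 i)}\Lambda_{(6,1)}(x-\frac56 i)$; $T^{(3)}(x)=\frac{1}{\phi(x\pm\frac32 i)}\Lambda_{(11,6,6)/(5,5)}(x)$; $T^{(5)}(x)=T_2(x+\frac53 i)$; $$\begin{aligned}T^{(6)}(x)=\tfrac1{\sqrt2}\Big(&w^2\phi(x+\tfrac23 i)\tfrac{Q(x+\frac23 i)}{Q(x-\frac13 i)}+w\,\phi(x-\tfrac43 i)\tfrac{Q(x-\frac43 i)Q(x+\frac53 i)}{Q(x-\frac13 i)Q(x+i)}+\phi(x)\tfrac{Q(x+\frac53 i)Q(x)}{Q(x+i)Q(x-i)}\\&+w^{-1}\phi(x+\tfrac43 i)\tfrac{Q(x+\frac43 i)Q(x-\frac53 i)}{Q(x+\frac13 i)Q(x-i)}+w^{-2}\phi(x-\tfrac23 i)\tfrac{Q(x-\frac23 i)}{Q(x+\frac13 i)}\Big);\end{aligned}$$ $T^{(4)}(x)=T^{(5)}(x-\frac16 i)T^{(6)}(x+\frac13 i)-\phi(x+\frac23 i)\phi(x-\frac13 i)T^{(6)}(x-\frac13 i)$; $T^{(7)}(x)=\frac{1}{\phi(x-\frac43 i)}\big(T^{(1)}(x+\frac12 i)T^{(6)}(x-\frac23 i)-\phi(x)\phi(x-i)T^{(6)}(x+\frac43 i)\big)$. With $y=x/6$: $Y^{(1)}(x)=\frac{\phi(y+\frac{10}6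 i)T^{(2)}(y)}{T_0(y\pm\frac56 i)}$, $Y^{(2)}(x)=\frac{T^{(1)}(y)T^{(3)}(y)}{T_0(y)T_0(y\pm\frac46 i)}$, $Y^{(3)}(x)=\frac{T^{(2)}(y)T^{(4)}(y)T^{(7)}(y)}{T_0(y\pm\frac16 i)T_0(y\pm\frac12 i)}$, $Y^{(4)}(x)=\frac{T^{(3)}(y)T^{(5)}(y)}{T_0(y)T_0(y\pm\frac13 i)}$, $Y^{(5)}(x)=\frac{T^{(4)}(y)T^{(6)}(y)}{T_0(y\pm\frac16 i)}$, $Y^{(6)}(x)=\frac{T^{(5)}(y)}{T_0(y)}$, $Y^{(7)}(x)=\frac{T^{(3)}(y)}{T_0(y\pm\frac13 i)}$. Case $L=6$. Set $T^{(6)}(x)=T_1(x)$; $$\begin{aligned}T^{(1)}(x)=T^{(5)}(x)=\tfrac12\Big(&w^3\phi(x+\tfrac34 i)\tfrac{Q(x+\frac34 i)}{Q(x-\frac14 i)}+w^2\phi(x-\tfrac54 i)\tfrac{Q(x-\frac54 i)Q(x-\frac74 i)}{Q(x-\frac14 i)Q(x+\frac54 i)}+w\,\phi(x+\tfrac14 i)\tfrac{Q(x+\frac14 i)Q(x-\frac74 i)}{Q(x-\frac34 i)Q(x+\frac54 i)}\\ &+\phi(x-\tfrac74 i)\tfrac{Q(x-\frac74 i)^2}{Q(x-\frac34 i)Q(x+\frac34 i)}+w^{-1}\phi(x-\tfrac14 i)\tfrac{Q(x-\frac14 i)Q(x+\frac74 i)}{Q(x+\frac34 i)Q(x-\frac54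 i)}\\ &+w^{-2}\phi(x+\tfrac54 i)\tfrac{Q(x+\frac54 i)Q(x+\frac74 i)}{Q(x+\frac14 i)Q(x-\frac54 i)}+w^{-3}\phi(x-\tfrac34 i)\tfrac{Q(x-\frac34 i)}{Q(x+\frac14 i)}\Big);\end{aligned}$$ $T^{(2)}(x)=T^{(4)}(x)=T^{(1)}(x-\frac14 i)T^{(1)}(x+\frac14 i)-T_0(x)$; $T^{(3)}(x)=\frac{1}{\phi(x+\frac74 i)}\big(T_1(x-\frac14 i)T_1(x+\frac14 i)-T_0(x\pm\frac34 i)\big)$. With $y=x/4$: $Y^{(1)}(x)=Y^{(5)}(x)=\frac{T^{(2)}(y)}{T_0(y)}$, $Y^{(2)}(x)=Y^{(4)}(x)=\frac{T^{(1)}(y)T^{(3)}(y)}{T_0(y\pm\frac14 i)}$, $Y^{(3)}(x)=\frac{(T^{(2)}(y))^2T^{(6)}(y)}{T_0(y)T_0(y\pm\frac12 i)}$, $Y^{(6)}(x)=\frac{\phi(y+\frac74 i)T^{(3)}(y)}{T_0(y\pm\frac34 i)}$. *)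

(* Defs.v *)
From HB Require Import structures.
From mathcomp Require Import all_boot all_order all_algebra.
From mathcomp Require Import complex.
From mathcomp Require Import boolp classical_sets reals topology normedtype.
From mathcomp Require Import sequences exp trigo.

Set Implicit Arguments.
Unset Strict Implicit.
Unset Printing Implicit Defensive.

Import Order.TTheory GRing.Theory Num.Theory numFieldNormedType.Exports.

Local Open Scope classical_set_scope.
Local Open Scope complex_scope.
Local Open Scope ring_scope.

(* R[i] does not receive the norm topology that the library puts on every
   numClosedFieldType, because it is a concrete type; copy it. *)
HB.instance Definition _ (R : realType) := NormedModule.copy R[i] (R[i]^o).

Notation Ci := ('i%C).

(* Equality of meromorphic functions represented by total functions, where
   division by zero yields junk values (also at removable singularities): the
   two sides agree in a punctured neighbourhood of every point, i.e. outside a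
   closed discrete set. *)
Definition mero_eq (R : realType) (f g : R[i] -> R[i]) : Prop :=
  forall z : R[i], \forall x \near z^', f x = g x.

Notation "f =m g" := (mero_eq f g) (at level 70, no associativity).

Definition cexp (R : realType) (z : R[i]) : R[i] :=
  (expR (complex.Re z))%:C * (cos (complex.Im z) +i* sin (complex.Im z)).

Definition csin (R : realType) (z : R[i]) : R[i] :=
  (cexp (Ci * z) - cexp (- (Ci * z))) / (2 * Ci).

Definition ccos (R : realType) (z : R[i]) : R[i] :=
  (cexp (Ci * z) + cexp (- (Ci * z))) / 2.

Definition theta1 (R : realType) (tau : R) (z : R[i]) : R[i] :=
  let q := expR (- tau) in
  2 * (q `^ (4^-1))%:C * csin z *
  lim ((fun m : nat => \prod_(1 <= n < m.+1)
         ((1 - 2 * q%:C ^+ (2 * n) * ccos (2 * z) + q%:C ^+ (4 * n)) *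
          (1 - q%:C ^+ (2 * n)))) @ \oo).

(* pm f x y is f(x +- iy) := f(x + iy) f(x - iy). *)
Definition pm (R : realType) (f : R[i] -> R[i]) (x y : R[i]) : R[i] :=
  f (x + y * Ci) * f (x - y * Ci).

Variant dilute := A4 | A6.

Definition level (M : dilute) : nat := match M with A4 => 4 | A6 => 6 end.

Section Basic.
Variables (R : realType) (M : dilute) (tau u : R) (N : nat).
Variable xs : 'I_N -> R[i].

Local Notation L := (level M).

Definition eta : R := pi * (L + 2)%:R / (4 * (L + 1)%:R).

Definition h (x : R[i]) : R[i] := theta1 tau (Ci * eta%:C * x).

Definition w : R[i] := cexp (Ci * (pi / (L + 1)%:R : R)%:C).

Definition phi (x : R[i]) : R[i] :=
  ((h (x + (3 / 2 - u%:C) * Ci) * h (x - (3 / 2 - u%:C) * Ci))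
   / (h (2 * Ci) * h (3 * Ci))) ^+ (N./2).

Definition Q (x : R[i]) : R[i] := \prod_(j < N) h (x - xs j).

(* The two nonvanishing conditions say that the fractions are defined. *)
Definition bethe_equations : Prop := forall j : 'I_N,
  [/\ phi (xs j - Ci) != 0,
      Q (xs j + Ci) * Q (xs j - 2 * Ci) != 0 &
      w * (phi (xs j + Ci) / phi (xs j - Ci)) =
      - (Q (xs j - Ci) * Q (xs j + 2 * Ci) / (Q (xs j + Ci) * Q (xs j - 2 * Ci)))].

Definition box1 (x : R[i]) : R[i] :=
  w * phi (x + 3 / 2 * Ci) * phi (x + 1 / 2 * Ci)
  * (Q (x - 5 / 2 * Ci) / Q (x - 1 / 2 * Ci)).

Definition box2 (x : R[i]) : R[i] :=
  phi (x + 3 / 2 * Ci) * phi (x - 3 / 2 * Ci)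
  * (Q (x - 3 / 2 * Ci) * Q (x + 3 / 2 * Ci)
     / (Q (x - 1 / 2 * Ci) * Q (x + 1 / 2 * Ci))).

Definition box3 (x : R[i]) : R[i] :=
  w^-1 * phi (x - 3 / 2 * Ci) * phi (x - 1 / 2 * Ci)
  * (Q (x + 5 / 2 * Ci) / Q (x + 1 / 2 * Ci)).

Definition box (i : 'I_3) : R[i] -> R[i] :=
  match val i with 0%N => box1 | 1%N => box2 | _ => box3 end.

Definition row_norm (m : nat) (x : R[i]) : R[i] :=
  \prod_(1 <= j < m) pm phi x ((2 * m%:R - 1) / 2 - j%:R).

Definition one_row (m : nat) (x : R[i]) : R[i] :=
  (row_norm m x)^-1 *
  \sum_(t : m.-tuple 'I_3 | sorted (fun a b : 'I_3 => (a <= b)%N) t)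
    \prod_(k < m) box (tnth t k) (x + (2 * k.+1%:R - 1 - m%:R) * Ci).

Definition T (m : int) (x : R[i]) : R[i] :=
  match m with
  | Posz 0 => pm phi x (1 / 2)
  | Posz m => one_row m x
  | Negz _ => 0
  end.

(* For L = 4 this reads T_m = T_(7-m), T_8 = T_9 = 0, T_(m+10) = T_m, and for
   L = 6 it reads T_m = T_(11-m), T_12 = T_13 = 0, T_(m+14) = T_m. *)
Definition largest_eigenvalue_sector : Prop :=
  let p : int := (2 * L - 1)%:Z in
  [/\ forall x : R[i], Q x = (Q (x^*)%C)^*%C,
      forall m : int, 0 <= m <= p -> T m =m T (p - m),
      T (p + 1) =m (fun=> 0) /\ T (p + 2) =m (fun=> 0) &
      forall m : int, -1 <= m -> T (m + (p + 3)) =m T m].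

End Basic.

Section DiluteA4.
Variables (R : realType) (tau u : R) (N : nat) (xs : 'I_N -> R[i]).

Local Notation w := (w R A4).
Local Notation phi := (phi A4 tau u N).
Local Notation Q := (Q A4 tau xs).
Local Notation T := (T A4 tau u xs).

Definition Tflat (m : int) (x : R[i]) : R[i] :=
  if 0 <= m <= 7 then T m x else 0.

(* A partition is the list of its (positive) parts, so that size mu is the
   number of rows; rows are numbered from 0 by j and k. *)
Definition Lambda (mu la : seq nat) (x : R[i]) : R[i] :=
  \det (\matrix_(j < size mu, k < size mu)
    Tflat ((nth 0%N mu j)%:Z - (nth 0%N la k)%:Z - j.+1%:Z + k.+1%:Z)
      (x + ((size mu)%:Z - (nth 0%N mu 0)%:Z + (nth 0%N mu j)%:Z
            + (nth 0%N la k)%:Z - j.+1%:Z - k.+1%:Z + 1)%:~R * Ci)).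

Definition T4_1 (x : R[i]) : R[i] := T 1 x.

Definition T4_2 (x : R[i]) : R[i] :=
  (phi (x - 5 / 3 * Ci))^-1 * Lambda [:: 6; 1] [::] (x - 5 / 6 * Ci).

Definition T4_3 (x : R[i]) : R[i] :=
  (pm phi x (3 / 2))^-1 * Lambda [:: 11; 6; 6] [:: 5; 5] x.

Definition T4_5 (x : R[i]) : R[i] := T 2 (x + 5 / 3 * Ci).

Definition T4_6 (x : R[i]) : R[i] :=
  ((Num.sqrt 2 : R)%:C)^-1 *
  (  w ^+ 2 * phi (x + 2 / 3 * Ci) * (Q (x + 2 / 3 * Ci) / Q (x - 1 / 3 * Ci))
   + w * phi (x - 4 / 3 * Ci)
     * (Q (x - 4 / 3 * Ci) * Q (x + 5 / 3 * Ci) / (Q (x - 1 / 3 * Ci) * Q (x + Ci)))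
   + phi x * (Q (x + 5 / 3 * Ci) * Q x / (Q (x + Ci) * Q (x - Ci)))
   + w^-1 * phi (x + 4 / 3 * Ci)
     * (Q (x + 4 / 3 * Ci) * Q (x - 5 / 3 * Ci) / (Q (x + 1 / 3 * Ci) * Q (x - Ci)))
   + w ^- 2 * phi (x - 2 / 3 * Ci) * (Q (x - 2 / 3 * Ci) / Q (x + 1 / 3 * Ci))).

Definition T4_4 (x : R[i]) : R[i] :=
  T4_5 (x - 1 / 6 * Ci) * T4_6 (x + 1 / 3 * Ci)
  - phi (x + 2 / 3 * Ci) * phi (x - 1 / 3 * Ci) * T4_6 (x - 1 / 3 * Ci).

Definition T4_7 (x : R[i]) : R[i] :=
  (phi (x - 4 / 3 * Ci))^-1 *
  (T4_1 (x + 1 / 2 * Ci) * T4_6 (x - 2 / 3 * Ci)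
   - phi x * phi (x - Ci) * T4_6 (x + 4 / 3 * Ci)).

Definition Y4 (a : nat) (x : R[i]) : R[i] :=
  let y := x / 6 in
  match a with
  | 1%N => phi (y + 10 / 6 * Ci) * T4_2 y / pm (T 0) y (5 / 6)
  | 2%N => T4_1 y * T4_3 y / (T 0 y * pm (T 0) y (4 / 6))
  | 3%N => T4_2 y * T4_4 y * T4_7 y / (pm (T 0) y (1 / 6) * pm (T 0) y (1 / 2))
  | 4%N => T4_3 y * T4_5 y / (T 0 y * pm (T 0) y (1 / 3))
  | 5%N => T4_4 y * T4_6 y / pm (T 0) y (1 / 6)
  | 6%N => T4_5 y / T 0 y
  | 7%N => T4_3 y / pm (T 0) y (1 / 3)
  | _ => 0
  end.

End DiluteA4.

Section DiluteA6.
Variables (R : realType) (tau u : R) (N : nat) (xs : 'I_N -> R[i]).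

Local Notation w := (w R A6).
Local Notation phi := (phi A6 tau u N).
Local Notation Q := (Q A6 tau xs).
Local Notation T := (T A6 tau u xs).

Definition T6_6 (x : R[i]) : R[i] := T 1 x.

Definition T6_1 (x : R[i]) : R[i] :=
  2^-1 *
  (  w ^+ 3 * phi (x + 3 / 4 * Ci) * (Q (x + 3 / 4 * Ci) / Q (x - 1 / 4 * Ci))
   + w ^+ 2 * phi (x - 5 / 4 * Ci)
     * (Q (x - 5 / 4 * Ci) * Q (x - 7 / 4 * Ci)
        / (Q (x - 1 / 4 * Ci) * Q (x + 5 / 4 * Ci)))
   + w * phi (x + 1 / 4 * Ci)
     * (Q (x + 1 / 4 * Ci) * Q (x - 7 / 4 * Ci)
        / (Q (x - 3 / 4 * Ci) * Q (x + 5 / 4 * Ci)))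
   + phi (x - 7 / 4 * Ci)
     * (Q (x - 7 / 4 * Ci) ^+ 2 / (Q (x - 3 / 4 * Ci) * Q (x + 3 / 4 * Ci)))
   + w^-1 * phi (x - 1 / 4 * Ci)
     * (Q (x - 1 / 4 * Ci) * Q (x + 7 / 4 * Ci)
        / (Q (x + 3 / 4 * Ci) * Q (x - 5 / 4 * Ci)))
   + w ^- 2 * phi (x + 5 / 4 * Ci)
     * (Q (x + 5 / 4 * Ci) * Q (x + 7 / 4 * Ci)
        / (Q (x + 1 / 4 * Ci) * Q (x - 5 / 4 * Ci)))
   + w ^- 3 * phi (x - 3 / 4 * Ci) * (Q (x - 3 / 4 * Ci) / Q (x + 1 / 4 * Ci))).

Definition T6_2 (x : R[i]) : R[i] :=
  T6_1 (x - 1 / 4 * Ci) * T6_1 (x + 1 / 4 * Ci) - T 0 x.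

(* The one-row function T_1 (not T6_1) enters here. *)
Definition T6_3 (x : R[i]) : R[i] :=
  (phi (x + 7 / 4 * Ci))^-1 *
  (T 1 (x - 1 / 4 * Ci) * T 1 (x + 1 / 4 * Ci) - pm (T 0) x (3 / 4)).

(* T^(5) = T^(1) and T^(4) = T^(2). *)
Definition Y6 (a : nat) (x : R[i]) : R[i] :=
  let y := x / 4 in
  match a with
  | 1%N | 5%N => T6_2 y / T 0 y
  | 2%N | 4%N => T6_1 y * T6_3 y / pm (T 0) y (1 / 4)
  | 3%N => T6_2 y ^+ 2 * T6_6 y / (T 0 y * pm (T 0) y (1 / 2))
  | 6%N => phi (y + 7 / 4 * Ci) * T6_3 y / pm (T 0) y (3 / 4)
  | _ => 0
  end.

End DiluteA6.

Definition Y (R : realType) (M : dilute) (tau u : R) (N : nat)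
    (xs : 'I_N -> R[i]) : nat -> R[i] -> R[i] :=
  match M with A4 => Y4 tau u xs | A6 => Y6 tau u xs end.

(* The Dynkin diagrams of E7 (for A4) and E6 (for A6). *)
Definition rank (M : dilute) : nat := match M with A4 => 7 | A6 => 6 end.

Definition dynkin_edges (M : dilute) : seq (nat * nat) :=
  match M with
  | A4 => [:: (1, 2); (2, 3); (3, 4); (4, 5); (5, 6); (3, 7)]%N
  | A6 => [:: (1, 2); (2, 3); (3, 4); (4, 5); (3, 6)]%N
  end.

Definition adjacent (M : dilute) : rel nat :=
  fun a b => ((a, b) \in dynkin_edges M) || ((b, a) \in dynkin_edges M).

(* Main.v *)
(** Put v = sqrt w, so v^(2(L+1)) = -1, and rescale Q along a chain of points
    p + k i to R_k = v^(-k) Q(p + k i).  With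
      gamma_k = phi(p + (k+1) i) R_{k+1} / (R_k R_{k+2})
    the products of boxes telescope and
      T_m(p + (m + 3/2) i) = R_0 R_{2m+3} sum_{0 <= a <= b <= m}
                                            gamma_{2a} gamma_{2b+1}.
    Since 2(L+1) i is a multiple of the period of phi and Q, gamma is
    antiperiodic of order 2(L+1), hence gamma_k = S_{k+2} - S_k for an
    antiperiodic S: a second solution of the TQ relation.  The functions T^(6)
    (L = 4) and T^(1) (L = 6) are S_k R_k up to a constant, and the truncation
    T_{2L+1} = 0 becomes the quadratic relation sum_k (-1)^k S_k S_{k+1} = 0.
    Every relation of the T-system behind the Y-system is then a polynomial
    identity between finitely many S_k modulo this one relation, the R_k only
    contributing common factors.  All of this is valid away from the zeros of
    phi and Q, which are isolated because the zeros of theta_1 lie on the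
    lattice pi Z + i tau Z. *)

From HB Require Import structures.
From mathcomp Require Import all_boot all_order all_algebra.
From mathcomp Require Import complex ring lra zify.
From mathcomp Require Import boolp classical_sets reals topology normedtype.
From mathcomp Require Import sequences exp trigo.
(* Imported last: the name [adjacent] is also defined in [sequences]. *)
Require Import Defs.

Set Implicit Arguments.
Unset Strict Implicit.
Unset Printing Implicit Defensive.

Import Order.TTheory GRing.Theory Num.Theory numFieldNormedType.Exports.

Local Open Scope classical_set_scope.
Local Open Scope complex_scope.
Local Open Scope ring_scope.

(** * Row sums over weakly increasing tuples *)

(** The relations to be checked in the S_k are kept few by reading the Dynkin diagram from the ends
    of its arms. Along an arm the T-functions are, up to factors phi, continuants (tridiagonal
    determinants) in the function at its end, with T_0 as off-diagonal weight. The relation at an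
    inner node of an arm is then a formal identity between continuants, true in any commutative
    ring. The S_k serve to start an arm when its first function has a given second one as neighbour,
    to show that arms with different ends reach the same function at the trivalent node, and to
    settle the relation at that node.

    The obstacle is that several T-functions are defined with a denominator phi, that is, a
    difference S_{k+2} - S_k. The quadratic relation helps to divide it out. For L = 4 the quotients
    are built from segments of the alternating sum of the S_k S_{k+1}, and in this form the
    remaining identities become accessible to [ring]. *)

Section SortedTuples.
Variables (F : fieldType).
Implicit Types B : nat -> nat -> F.

(** The lower bound l makes the sum recursive in the first entry of the tuple; l = 0 is the sum in
    [one_row]. *)
Definition tuple_sum l m B : F :=
  \sum_(t : m.-tuple 'I_3 | path (fun a b : nat => (a <= b)%N) l (map val t))
    \prod_(k < m) B (tnth t k) k.

Lemma tuple_sum0 l B : tuple_sum l 0 B = 1.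
Proof.
rewrite /tuple_sum (eq_bigl (pred1 [tuple])); last by move=> t; rewrite tuple0 /= eqxx.
by rewrite big_pred1_eq big_ord0.
Qed.

Lemma tuple_sumS l m B : tuple_sum l m.+1 B =
  \sum_(i < 3 | (l <= i)%N) B i 0 * tuple_sum i m (fun j k => B j k.+1).
Proof.
under eq_bigr => i _ do rewrite /tuple_sum big_distrr.
rewrite /tuple_sum pair_big_dep /=.
rewrite (reindex (fun p : 'I_3 * m.-tuple 'I_3 => cons_tuple p.1 p.2)) /=.
  apply: eq_bigr => -[i t] _; rewrite big_ord_recl /=; congr (_ * _).
  by apply: eq_bigr => k _; rewrite tnthS.
exists (fun t : m.+1.-tuple 'I_3 => (thead t, behead_tuple t)) => [[i t] _|t _] /=.
  by congr pair; apply: val_inj.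
by apply: val_inj; rewrite /= -[RHS]/(val t); case: t => -[].
Qed.

Lemma tuple_sumS2 m B : tuple_sum 2 m.+1 B = B 2 0 * tuple_sum 2 m (fun j k => B j k.+1).
Proof. by rewrite tuple_sumS !big_mkcond !big_ord_recr big_ord0 /= !add0r. Qed.

Lemma tuple_sumS1 m B : tuple_sum 1 m.+1 B =
  B 1 0 * tuple_sum 1 m (fun j k => B j k.+1) + tuple_sum 2 m.+1 B.
Proof. by rewrite tuple_sumS tuple_sumS2 !big_mkcond !big_ord_recr big_ord0 /= !add0r. Qed.

Lemma tuple_sumS0 m B : tuple_sum 0 m.+1 B =
  B 0 0 * tuple_sum 0 m (fun j k => B j k.+1) + tuple_sum 1 m.+1 B.
Proof.
by rewrite tuple_sumS tuple_sumS1 tuple_sumS2 !big_mkcond !big_ord_recr big_ord0 /= !add0r addrA.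
Qed.

Implicit Types ph R : nat -> F.

(** The box for entry j of a row, with its arguments written as points of the chain. No power of w
    is left, because R stands for the rescaled Q. *)
Definition lattice_box ph R (i j : nat) : F :=
  match i with
  | 0%N => ph j.*2.+4 * ph j.*2.+3 * (R j.*2 / R j.*2.+2)
  | 1%N => ph j.*2.+4 * ph j.*2.+1 * (R j.*2.+1 * R j.*2.+4 / (R j.*2.+2 * R j.*2.+3))
  | _ => ph j.*2.+1 * ph j.*2.+2 * (R j.*2.+1.+4 / R j.*2.+3)
  end.

Definition link ph R k := ph k.+1 * R k.+1 / (R k * R k.+2).

(** A weakly increasing tuple is determined by the number a of its entries 0 and the number b of its
    entries at most 1, and it contributes the single term gamma_{2a} gamma_{2b+1}. The bound l = 1
    forces a = 0, and l = 2 forces a = b = 0. The two links carry two more factors ph than the m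
    boxes, hence [ph 1 * ph 2] on the left. *)
Lemma tuple_sum_lattice ph R m :
  (forall k, ph k != 0) -> (forall k, R k != 0) ->
  [/\ tuple_sum 2 m (lattice_box ph R) * R 3 = (\prod_(i < m.*2) ph i.+1) * R m.*2.+3,
      tuple_sum 1 m (lattice_box ph R) * ph 1 * ph 2 =
        (\prod_(i < m.*2) ph i.+1) * R 0 * R m.*2.+3 *
        (link ph R 0 * \sum_(b < m.+1) link ph R b.*2.+1) &
      tuple_sum 0 m (lattice_box ph R) * ph 1 * ph 2 =
        (\prod_(i < m.*2) ph i.+1) * R 0 * R m.*2.+3 *
        \sum_(b < m.+1) (\sum_(a < b.+1) link ph R a.*2) * link ph R b.*2.+1].
Proof.
elim: m ph R => [|m IH] ph R ph0 R0.
  rewrite !tuple_sum0 double0 !(big_ord_recl, big_ord0) /= /link.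
  by split; field; rewrite ?ph0 ?R0.
(* Removing the first entry moves the whole chain by two points. *)
have [] := IH (fun k => ph k.+2) (fun k => R k.+2) (fun k => ph0 _) (fun k => R0 _).
rewrite -[lattice_box _ _]/(fun i j => lattice_box ph R i j.+1).
rewrite -[link _ _]/(fun k => link ph R k.+2).
set P := \prod_(i < _) _; set Sb := \sum_(b < _) _; set Sab := \sum_(b < _) _.
move=> I2 I1 I0.
have -> : \prod_(i < m.+1.*2) ph i.+1 = ph 1 * ph 2 * P.
  by rewrite doubleS !big_ord_recl mulrA.
have nz k : (ph k != 0) * (R k != 0) by [].
have {}I2 : tuple_sum 2 m (fun i j => lattice_box ph R i j.+1) = P * R m.*2.+4.+1 / R 5.
  by apply: (mulIf (R0 5)); rewrite I2; field; rewrite ?nz.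
have {}I1 : tuple_sum 1 m (fun i j => lattice_box ph R i j.+1) =
    P * R 2 * R m.*2.+4.+1 * (link ph R 2 * Sb) / (ph 3 * ph 4).
  apply: (mulIf (ph0 3)); apply: (mulIf (ph0 4)); rewrite I1.
  by field; rewrite ?nz.
have {}I0 : tuple_sum 0 m (fun i j => lattice_box ph R i j.+1) =
    P * R 2 * R m.*2.+4.+1 * Sab / (ph 3 * ph 4).
  apply: (mulIf (ph0 3)); apply: (mulIf (ph0 4)); rewrite I0.
  by field; rewrite ?nz.
have Sb_rec : \sum_(b < m.+2) link ph R b.*2.+1 = link ph R 1 + Sb.
  by rewrite big_ord_recl.
have Sab_rec : \sum_(b < m.+2) (\sum_(a < b.+1) link ph R a.*2) * link ph R b.*2.+1 =
    link ph R 0 * (link ph R 1 + Sb) + Sab.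
  rewrite big_ord_recl /= big_ord1 mulrDr -addrA; congr (_ + _).
  rewrite mulr_sumr -big_split; apply: eq_bigr => b _ /=.
  by rewrite big_ord_recl mulrDl.
rewrite Sb_rec Sab_rec tuple_sumS0 tuple_sumS1 tuple_sumS2 I2 I1 I0 /lattice_box /= /link.
by split; field; rewrite ?nz.
Qed.
End SortedTuples.

(** * Chains of points with step i *)

Section Lattice.
(** An integer point counts multiples of i/(2e), so a chain step is 2e points. A period is P points,
    h is L + 1, and 2h chain steps make z0 full periods. *)
Variables (F : fieldType) (e P z0 : int) (h : nat) (v : F) (phi q : int -> F)
  (Trow : nat -> int -> F).
Hypothesis two_neq0 : 2 != 0 :> F.
Hypothesis v_neq0 : v != 0.
Hypothesis v_anti : v ^+ (h.*2) = - 1.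
Hypothesis eP : 2 * e * (h.*2)%:Z = P * z0.
Hypothesis phi_per : forall n z, phi (n + P * z) = phi n.
Hypothesis q_per : forall n z, q (n + P * z) = q n.
Hypothesis phi_neq0 : forall n, phi n != 0.
Hypothesis q_neq0 : forall n, q n != 0.

Definition chain_phi c (k : nat) := phi (c + 2 * e * k%:Z).
Definition chain_Q c (k : nat) := v ^- k * q (c + 2 * e * k%:Z).
Definition chain_link c := link (chain_phi c) (chain_Q c).
(** Raising k by two drops the first link of the sum and appends its negative, so the sum changes by
    -2 times that link; this is the origin of the constant. *)
Definition chain_S c (k : nat) := - 2^-1 * \sum_(i < h) chain_link c (k + i.*2)%N.

Hypothesis Trow_per : forall m n z, Trow m (n + P * z) = Trow m n.
Hypothesis Trow_closed : forall c m, (0 < m)%N -> Trow m (c + e * (2 * m%:Z + 3)) =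
  chain_Q c 0 * chain_Q c m.*2.+3 * \sum_(b < m.+1) (\sum_(a < b.+1) chain_link c a.*2)
    * chain_link c b.*2.+1.

Lemma chain_Q_neq0 c k : chain_Q c k != 0.
Proof. by rewrite mulf_neq0 ?invr_neq0 ?expf_neq0. Qed.

Lemma chain_Q_anti c k : chain_Q c (k + h.*2)%N = - chain_Q c k.
Proof.
rewrite /chain_Q exprD v_anti mulrN1 invrN mulNr; congr (- (_ * _)).
by rewrite -[RHS](q_per _ z0) -eP; congr q; rewrite PoszD; ring.
Qed.

Lemma chain_link_anti c k : chain_link c (k + h.*2)%N = - chain_link c k.
Proof.
rewrite /chain_link /link -!addSn !chain_Q_anti.
have -> : chain_phi c (k.+1 + h.*2)%N = chain_phi c k.+1.
  by rewrite /chain_phi -[RHS](phi_per _ z0) -eP; congr phi; rewrite PoszD; ring.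
by field; rewrite !oppr_eq0 !chain_Q_neq0.
Qed.

Lemma chain_S_step c k : chain_S c k.+2 - chain_S c k = chain_link c k.
Proof.
have E : \sum_(i < h) chain_link c (k.+2 + i.*2)%N = \sum_(i < h) chain_link c (k + i.*2)%N
  - 2 * chain_link c k.
  have : \sum_(i < h.+1) chain_link c (k + i.*2)%N = \sum_(i < h) chain_link c (k + i.*2)%N
    - chain_link c k.
    by rewrite big_ord_recr /= chain_link_anti.
  rewrite big_ord_recl /= addn0; under eq_bigr => i _ do rewrite doubleS !addnS -!addSn.
  by move=> E; apply: (addrI (chain_link c k)); rewrite E; ring.
by rewrite /chain_S E; field.
Qed.

Lemma chain_S_anti c k : chain_S c (k + h.*2)%N = - chain_S c k.
Proof.
rewrite /chain_S -mulrN; congr (_ * _); rewrite -sumrN.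
by apply: eq_bigr => i _; rewrite addnAC chain_link_anti.
Qed.

Lemma phi_chain c k z n : n = c + 2 * e * k%:Z + 2 * e + P * z ->
  phi n = (chain_S c k.+2 - chain_S c k) * chain_Q c k * chain_Q c k.+2 / chain_Q c k.+1.
Proof.
move=> ->; rewrite phi_per chain_S_step /chain_link /link.
have -> : phi (c + 2 * e * k%:Z + 2 * e) = chain_phi c k.+1 by rewrite /chain_phi; congr phi;
  rewrite intS; ring.
by field; rewrite !chain_Q_neq0.
Qed.

(** Restarting the chain at its k-th point multiplies each R by v^k and each link by v^-k. The
    powers cancel in a product of two R and two links, and the inner sum of links telescopes. *)
Lemma row_chain c m k z n : (0 < m)%N -> n = c + 2 * e * k%:Z + e * (2 * m%:Z + 3) + P * z ->
  Trow m n = chain_Q c k * chain_Q c (k + m.*2.+3)%N *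
   \sum_(b < m.+1) (chain_S c (k + b.*2.+2)%N - chain_S c k)
     * (chain_S c (k + b.*2.+3)%N - chain_S c (k + b.*2.+1)%N).
Proof.
move=> m0 ->; rewrite Trow_per Trow_closed //.
have RE j : chain_Q (c + 2 * e * k%:Z) j = v ^+ k * chain_Q c (k + j)%N.
  rewrite /chain_Q (_ : c + _ + _ = c + 2 * e * (k + j)%N%:Z); last by rewrite PoszD; ring.
  by rewrite exprD; field; rewrite !expf_neq0.
have gE j : chain_link (c + 2 * e * k%:Z) j = v ^- k * chain_link c (k + j)%N.
  rewrite /chain_link /link !RE /chain_phi (_ : c + _ + _ = c + 2 * e * (k + j).+1%:Z);
    last by rewrite -addnS PoszD; ring.
  by rewrite !addnS; field; rewrite !expf_neq0 // !chain_Q_neq0.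
have sumE b : \sum_(a < b) chain_link (c + 2 * e * k%:Z) a.*2
  = v ^- k * (chain_S c (k + b.*2)%N - chain_S c k).
  elim: b => [|b IH]; first by rewrite big_ord0 addn0 subrr mulr0.
  by rewrite big_ord_recr IH /= gE -chain_S_step doubleS !addnS; ring.
under eq_bigr => b _ do rewrite sumE gE addnS -chain_S_step -!addnS.
rewrite !RE addn0 !mulr_sumr; apply: eq_bigr => b _.
by rewrite doubleS; field; rewrite !expf_neq0.
Qed.

End Lattice.

(** * The E7 T-system *)

Ltac index_to a b := rewrite (_ : a = b :> int); last by ring.

Module E7.
Section TSystem.
Variables (F : fieldType) (kap : F) (phi T1 T5 T6 : int -> F).
Hypothesis kap2 : kap ^+ 2 = - 2.
Hypothesis phi_neq0 : forall n, phi n != 0.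

Definition T0 n := phi (n + 3) * phi (n - 3).

(* A point n stands for a shift by n i/6, so that the period is 20 and the
   k-th point of the chain through c is c + 6 k; z counts periods.  T5 is T_2
   shifted by half a period. *)
Record lattice (c : int) := Lattice {
  S : nat -> F; R : nat -> F;
  R_neq0 : forall k, R k != 0;
  S_anti : forall k, S (k + 10)%N = - S k;
  R_anti : forall k, R (k + 10)%N = - R k;
  S_rel : forall k, S k * S (k + 9)%N =
     - S k * S k.+1 + S k.+1 * S k.+2 - S k.+2 * S k.+3 + S k.+3 * S k.+4
     - S k.+4 * S (k + 5)%N + S (k + 5)%N * S (k + 6)%N - S (k + 6)%N * S (k + 7)%N
     + S (k + 7)%N * S (k + 8)%N - S (k + 8)%N * S (k + 9)%N;
  phiE : forall k z n, n = c + 6 * k%:Z + 6 + 20 * z ->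
    phi n = (S k.+2 - S k) * R k * R k.+2 / R k.+1;
  T6E : forall k z n, n = c + 6 * k%:Z - 10 + 20 * z -> T6 n = kap * S k * R k;
  T1E : forall k z n, n = c + 6 * k%:Z + 15 + 20 * z ->
    T1 n = R k * R (k + 5)%N * ((S k.+2 - S k) * (S k.+3 - S k.+1)
      + (S k.+2 - S k) * (S (k + 5)%N - S k.+3) + (S k.+4 - S k.+2) * (S (k + 5)%N - S k.+3));
  T5E : forall k z n, n = c + 6 * k%:Z + 11 + 20 * z ->
    T5 n = R k * R (k + 7)%N * ((S k.+2 - S k) * (S (k + 7)%N - S k.+1)
      + (S k.+4 - S k.+2) * (S (k + 7)%N - S k.+3) + (S (k + 6)%N - S k.+4)
          * (S (k + 7)%N - S (k + 5)%N)) }.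

Hypothesis lat : forall c, lattice c.

Lemma T0E c (l : lattice c) k z n : n = c + 6 * k%:Z + 9 + 20 * z ->
  T0 n = R l k * R l k.+3 * (S l k.+2 - S l k) * (S l k.+3 - S l k.+1).
Proof.
move=> nE; rewrite /T0 (@phiE _ l k.+1 z); last lia.
rewrite (@phiE _ l k z); last lia.
by field; rewrite !R_neq0.
Qed.

Lemma kapM : kap * kap = - 2. Proof. by rewrite -expr2. Qed.

(** Kept transparent, so that its sequences unfold to [S l (j + k)]; a statement at a general k is
    thereby reduced to numeral indices. *)
Definition shift c (l : lattice c) (j : nat) : lattice (c + 6 * j%:Z).
Proof.
exists (fun k => S l (j + k)%N) (fun k => R l (j + k)%N).
- by move=> k; exact: R_neq0.
- by move=> k; rewrite addnA S_anti.
- by move=> k; rewrite addnA R_anti.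
- by move=> k; have := S_rel l (j + k)%N; rewrite !addnA !addnS.
- move=> k z n nE; rewrite (@phiE _ l (j + k)%N z) ?addnS //; lia.
- move=> k z n nE; rewrite (@T6E _ l (j + k)%N z) ?addnS //; lia.
- move=> k z n nE; rewrite (@T1E _ l (j + k)%N z) ?addnA ?addnS //; lia.
- move=> k z n nE; rewrite (@T5E _ l (j + k)%N z) ?addnA ?addnS //; lia.
Defined.

Ltac normalize_indices l := rewrite /= ?(S_anti l 0) ?(S_anti l 1) ?(S_anti l 2) ?(S_anti l 3)
  ?(S_anti l 4)
  ?(S_anti l 5) ?(S_anti l 6) ?(S_anti l 7) ?(S_anti l 8) ?(S_anti l 9)
  ?(R_anti l 0) ?(R_anti l 1) ?(R_anti l 2) ?(R_anti l 3) ?(R_anti l 4)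
  ?(R_anti l 5) ?(R_anti l 6) ?(R_anti l 7) ?(R_anti l 8) ?(R_anti l 9).

(** After division by the common R factors, the two sides differ by the alternating sum in
    [S_rel]. *)
Lemma T5_T6 n : T5 n = T6 (n - 1) * T6 (n + 1) - T0 n.
Proof.
have l := lat (n - 11).
rewrite (@T5E _ l 0 0); last lia.
rewrite (@T6E _ l 0 1); last lia.
rewrite (@T6E _ l 7 (-1)); last lia.
rewrite (@T0E _ l 7 (-2)); last lia.
move: (S_rel l 0); normalize_indices l => E.
ring: E kapM.
Qed.

Definition T7 n := (T1 (n + 3) * T6 (n - 4) - phi n * phi (n - 6) * T6 (n + 8)) / phi (n - 8).

(** The bracket is the segment from k + 2 to k + 8 of the alternating sum in [S_rel]; the
    denominator of [T7] has disappeared. *)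
Lemma T7E c (l : lattice c) k z n : n = c + 6 * k%:Z + 20 * z ->
  T7 n = kap * R l (k + 2)%N * R l (k + 8)%N
    * (- S l (k + 2)%N * S l (k + 3)%N + S l (k + 3)%N * S l (k + 4)%N
       - S l (k + 4)%N * S l (k + 5)%N
       + S l (k + 5)%N * S l (k + 6)%N - S l (k + 6)%N * S l (k + 7)%N
       + S l (k + 7)%N * S l (k + 8)%N).
Proof.
move=> nE; rewrite /T7.
pose l' := shift l k.
rewrite -![S l _]/(S l' _) -![R l _]/(R l' _).
move: l'; move: {l k}(c + _) nE => {}c nE l.
rewrite (@T1E _ l 8 (z - 3)); last lia.
rewrite (@T6E _ l 1 z); last lia.
rewrite (@T6E _ l 3 z); last lia.
rewrite (@phiE _ l 9 (z - 3)); last lia.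
rewrite (@phiE _ l 8 (z - 3)); last lia.
move: (phi_neq0 (n - 8)); rewrite (@phiE _ l 1 (z - 1)); last lia.
move: (S_rel l 0); normalize_indices l => E p.
(* The only factor of phi (n - 8) that is not already known to be nonzero. *)
have {p} : S l 3 - S l 1 != 0 by apply: contraNneq p => ->; rewrite !mul0r.
move=> p; by field: E kapM; rewrite ?p ?oppr_eq0 ?R_neq0.
Qed.

(* T2 and T3 are the two determinants Lambda, expanded with T_6 = T_1 and
   T_7 = T_0. *)
Definition T2 n := (T1 (n + 1) * T1 (n - 1) - T0 (n + 5) * T0 (n - 5)) / phi (n + 10).

Definition T3 n := (T1 (n + 2) * T1 n * T1 (n - 2) - T1 (n + 2) * T0 (n + 4) * T0 (n - 6)
   - T0 (n - 4) * T0 (n + 6) * T1 (n - 2)) / (phi (n + 9) * phi (n - 9)).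

Definition T4 n := T5 (n - 1) * T6 (n + 2) - phi (n + 4) * phi (n - 2) * T6 (n - 2).

(** Up to sign, the two long brackets are the segments from 1 to 5 and from 5 to 9 of the
    alternating sum in [S_rel]. *)
Lemma T2E n (l : lattice n) :
  T2 n = R l 1 * R l 5 * R l 9 *
   ((S l 5 - S l 9) * (- S l 1 * S l 2 + S l 2 * S l 3 - S l 3 * S l 4 + S l 4 * S l 5)
    + (S l 1 - S l 5) * (S l 5 * S l 6 - S l 6 * S l 7 + S l 7 * S l 8 - S l 8 * S l 9)).
Proof.
rewrite /T2.
rewrite (@T1E _ l 1 (-1) (n + 1)); last lia.
rewrite (@T1E _ l 4 (-2) (n - 1)); last lia.
rewrite (@T0E _ l 6 (-2) (n + 5)); last lia.
rewrite (@T0E _ l 1 (-1) (n - 5)); last lia.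
move: (phi_neq0 (n + 10)).
rewrite (@phiE _ l 4 (-1) (n + 10)); last lia.
move: (S_rel l 0); normalize_indices l => E p.
have {p} : S l 6 - S l 4 != 0 by apply: contraNneq p => ->; rewrite !mul0r.
by move=> p; field: E; rewrite ?p ?oppr_eq0 ?R_neq0.
Qed.

(** The continuant of length three on the arm of node 1, divided by two factors phi, agrees with the
    one of length two on the arm of node 7. *)
Lemma T3E n : T3 n = T7 (n + 1) * T7 (n - 1) - T0 (n + 2) * T0 (n - 2).
Proof.
have l := lat (n - 1).
rewrite /T3.
rewrite (@T1E _ l 8 (-3) (n + 2)); last lia.
rewrite (@T1E _ l 1 (-1) n); last lia.
rewrite (@T1E _ l 4 (-2) (n - 2)); last lia.
rewrite (@T0E _ l 6 (-2) (n + 4)); last lia.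
rewrite (@T0E _ l 1 (-1) (n - 6)); last lia.
rewrite (@T0E _ l 8 (-3) (n - 4)); last lia.
rewrite (@T0E _ l 3 (-1) (n + 6)); last lia.
rewrite (@T7E _ l 7 (-2) (n + 1)); last lia.
rewrite (@T7E _ l 0 0 (n - 1)); last lia.
rewrite (@T0E _ l 9 (-3) (n + 2)); last lia.
rewrite (@T0E _ l 5 (-2) (n - 2)); last lia.
move: (phi_neq0 (n + 9)) (phi_neq0 (n - 9)).
rewrite (@phiE _ l 4 (-1) (n + 9)); last lia.
rewrite (@phiE _ l 1 (-1) (n - 9)); last lia.
move: (S_rel l 0); normalize_indices l => E p1 p2.
have {p1} : S l 6 - S l 4 != 0 by apply: contraNneq p1 => ->; rewrite !mul0r.
have {p2} : S l 3 - S l 1 != 0 by apply: contraNneq p2 => ->; rewrite !mul0r.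
by move=> p2 p1; field: E kapM; rewrite ?p1 ?p2 ?R_neq0.
Qed.

Lemma T4E n : T4 n = T6 (n - 2) * T6 n * T6 (n + 2) - T0 (n - 1) * T6 (n + 2)
  - T0 (n + 1) * T6 (n - 2).
Proof.
rewrite /T4 T5_T6.
index_to (n - 1 - 1) (n - 2). index_to (n - 1 + 1) (n).
rewrite /T0; index_to (n + 1 + 3) (n + 4).
index_to (n + 1 - 3) (n - 2).
ring.
Qed.

(* The relation at the trivalent node, divided by T7 n. *)
Lemma T7_cubic n : T7 n * T7 (n - 2) * T7 (n + 2) - T7 (n - 2) * T0 (n - 1) * T0 (n + 3)
   - T7 (n + 2) * T0 (n + 1) * T0 (n - 3) = T2 n * T4 n.
Proof.
have l := lat n.
rewrite T4E.
rewrite (T2E l).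
rewrite (@T7E _ l 0 0 n); last lia.
rewrite (@T7E _ l 3 (-1) (n - 2)); last lia.
rewrite (@T7E _ l 7 (-2) (n + 2)); last lia.
rewrite (@T0E _ l 5 (-2) (n - 1)); last lia.
rewrite (@T0E _ l 9 (-3) (n + 3)); last lia.
rewrite (@T0E _ l 2 (-1) (n + 1)); last lia.
rewrite (@T0E _ l 8 (-3) (n - 3)); last lia.
rewrite (@T6E _ l 5 (-1) n); last lia.
rewrite (@T6E _ l 2 0 (n + 2)); last lia.
rewrite (@T6E _ l 8 (-2) (n - 2)); last lia.
move: (S_rel l 0); normalize_indices l => E.
ring: E kapM.
Qed.

(** The left side is T3; the right side is the continuant of length four on the arm of node 6,
    expanded at its last entry. All three arms now meet at node 3. *)
Lemma T3_continuant n : T7 (n + 1) * T7 (n - 1) - T0 (n + 2) * T0 (n - 2) =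
   T6 (n + 3) * T4 (n - 1) - T0 (n + 2) * T5 (n - 2).
Proof.
have l := lat (n - 1).
rewrite T4E T5_T6.
index_to (n - 1 - 2) (n - 3). index_to (n - 1 + 2) (n + 1). index_to (n - 1 - 1) (n - 2).
index_to (n - 1 + 1) (n). index_to (n - 2 - 1) (n - 3). index_to (n - 2 + 1) (n - 1).
rewrite (@T7E _ l 7 (-2) (n + 1)); last lia.
rewrite (@T7E _ l 0 0 (n - 1)); last lia.
rewrite (@T0E _ l 9 (-3) (n + 2)); last lia.
rewrite (@T0E _ l 5 (-2) (n - 2)); last lia.
rewrite (@T6E _ l 9 (-2) (n + 3)); last lia.
rewrite (@T6E _ l 8 (-2) (n - 3)); last lia.
rewrite (@T6E _ l 5 (-1) (n - 1)); last lia.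
rewrite (@T6E _ l 2 0 (n + 1)); last lia.
rewrite (@T0E _ l 2 (-1) n); last lia.
move: (S_rel l 0); normalize_indices l => E.
ring: E kapM.
Qed.

Hypothesis phi_per : forall n, phi (n + 20) = phi n.

Lemma rel_T2 n : T2 (n + 1) * T2 (n - 1) = T0 n * T0 (n + 4) * T0 (n - 4) + T1 n * T3 n.
Proof.
rewrite /T2 /T3.
index_to (n + 1 + 1) (n + 2). index_to (n + 1 - 1) (n). index_to (n - 1 + 1) (n).
index_to (n - 1 - 1) (n - 2). index_to (n + 1 + 5) (n + 6). index_to (n + 1 - 5) (n - 4).
index_to (n - 1 + 5) (n + 4). index_to (n - 1 - 5) (n - 6). index_to (n - 1 + 10) (n + 9).
have -> : phi (n + 1 + 10) = phi (n - 9) by rewrite -[RHS]phi_per; congr phi; ring.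
(* The outermost T0 of the continuants supply exactly the two denominators phi. *)
have e : T0 (n + 6) * T0 (n - 6) = T0 n * phi (n + 9) * phi (n - 9).
  rewrite /T0. index_to (n + 6 + 3) (n + 9).
index_to (n + 6 - 3) (n + 3). index_to (n - 6 + 3) (n - 3). index_to (n - 6 - 3) (n - 9).
  ring.
by field: e; rewrite !phi_neq0.
Qed.

(** With both T3 written through T7, the factor T7 n splits off and leaves the relation of
    [T7_cubic]. *)
Lemma rel_T3 n : T3 (n + 1) * T3 (n - 1) =
  T0 (n + 1) * T0 (n - 1) * (T0 (n + 3) * T0 (n - 3)) + T2 n * T4 n * T7 n.
Proof.
rewrite !T3E -T7_cubic.
index_to (n + 1 + 1) (n + 2). index_to (n + 1 - 1) (n). index_to (n - 1 + 1) (n).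
index_to (n - 1 - 1) (n - 2). index_to (n + 1 + 2) (n + 3). index_to (n + 1 - 2) (n - 1).
index_to (n - 1 + 2) (n + 1). index_to (n - 1 - 2) (n - 3).
ring.
Qed.

Lemma rel_T7 n : T7 (n + 1) * T7 (n - 1) = T0 (n + 2) * T0 (n - 2) + T3 n.
Proof. by rewrite T3E; ring. Qed.

Lemma rel_T5 n : T5 (n + 1) * T5 (n - 1) = T0 (n + 1) * T0 (n - 1) + T4 n * T6 n.
Proof.
rewrite !T5_T6 T4E.
index_to (n + 1 + 1) (n + 2). index_to (n + 1 - 1) (n). index_to (n - 1 + 1) (n).
index_to (n - 1 - 1) (n - 2).
ring.
Qed.

(** Once T3, T4 and T5 are continuants in T6, this is a formal identity. *)
Lemma rel_T4 n : T4 (n + 1) * T4 (n - 1) = T0 n * (T0 (n + 2) * T0 (n - 2)) + T3 n * T5 n.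
Proof.
rewrite T3E T3_continuant !T5_T6 !T4E.
index_to (n + 1 - 2) (n - 1). index_to (n + 1 + 2) (n + 3). index_to (n + 1 - 1) (n).
index_to (n + 1 + 1) (n + 2). index_to (n - 1 - 2) (n - 3). index_to (n - 1 + 2) (n + 1).
index_to (n - 1 + 1) (n). index_to (n - 1 - 1) (n - 2). index_to (n - 2 - 1) (n - 3).
index_to (n - 2 + 1) (n - 1).
ring.
Qed.

Definition Y (a : nat) (n : int) : F :=
  match a with
  | 1%N => phi (n + 10) * T2 n / (T0 (n + 5) * T0 (n - 5))
  | 2%N => T1 n * T3 n / (T0 n * (T0 (n + 4) * T0 (n - 4)))
  | 3%N => T2 n * T4 n * T7 n / (T0 (n + 1) * T0 (n - 1) * (T0 (n + 3) * T0 (n - 3)))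
  | 4%N => T3 n * T5 n / (T0 n * (T0 (n + 2) * T0 (n - 2)))
  | 5%N => T4 n * T6 n / (T0 (n + 1) * T0 (n - 1))
  | 6%N => T5 n / T0 n
  | 7%N => T3 n / (T0 (n + 2) * T0 (n - 2))
  | _ => 0
  end.

Lemma T0_neq0 n : T0 n != 0. Proof. by rewrite mulf_neq0. Qed.

Lemma one_plus_Y1 n : 1 + Y 1 n = T1 (n + 1) * T1 (n - 1) / (T0 (n + 5) * T0 (n - 5)).
Proof. by rewrite /= /T2; field; rewrite !T0_neq0 phi_neq0. Qed.
Lemma one_plus_Y2 n : 1 + Y 2 n = T2 (n + 1) * T2 (n - 1) / (T0 n * (T0 (n + 4) * T0 (n - 4))).
Proof. by rewrite rel_T2 /=; field; rewrite !T0_neq0. Qed.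
Lemma one_plus_Y3 n : 1 + Y 3 n = T3 (n + 1) * T3 (n - 1)
  / (T0 (n + 1) * T0 (n - 1) * (T0 (n + 3) * T0 (n - 3))).
Proof. by rewrite rel_T3 /=; field; rewrite !T0_neq0. Qed.
Lemma one_plus_Y4 n : 1 + Y 4 n = T4 (n + 1) * T4 (n - 1) / (T0 n * (T0 (n + 2) * T0 (n - 2))).
Proof. by rewrite rel_T4 /=; field; rewrite !T0_neq0. Qed.
Lemma one_plus_Y5 n : 1 + Y 5 n = T5 (n + 1) * T5 (n - 1) / (T0 (n + 1) * T0 (n - 1)).
Proof. by rewrite rel_T5 /=; field; rewrite !T0_neq0. Qed.
Lemma one_plus_Y6 n : 1 + Y 6 n = T6 (n + 1) * T6 (n - 1) / T0 n.
Proof. by rewrite /= T5_T6; field; rewrite !T0_neq0. Qed.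
Lemma one_plus_Y7 n : 1 + Y 7 n = T7 (n + 1) * T7 (n - 1) / (T0 (n + 2) * T0 (n - 2)).
Proof. by rewrite rel_T7 /=; field; rewrite !T0_neq0. Qed.

(** The numerator of Y a is the product of the neighbouring T b, up to a factor phi at node 1, and
    each 1 + Y b is T b (n + 1) T b (n - 1) over factors T0. Only the T0 and phi remain to be
    compared. *)
Lemma Y_system a n : (1 <= a <= 7)%N ->
  Y a (n - 1) * Y a (n + 1) =
    match a with
    | 1%N => 1 + Y 2 n
    | 2%N => (1 + Y 1 n) * (1 + Y 3 n)
    | 3%N => (1 + Y 2 n) * (1 + Y 4 n) * (1 + Y 7 n)
    | 4%N => (1 + Y 3 n) * (1 + Y 5 n)
    | 5%N => (1 + Y 4 n) * (1 + Y 6 n)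
    | 6%N => 1 + Y 5 n
    | _ => 1 + Y 3 n
    end.
Proof.
have E i j k : i + j = k -> n + i + j = n + k by move=> <-; rewrite addrA.
have {}E := (addrK 1 n : n + 1 - 1 = n, subrK 1 n : n - 1 + 1 = n, E 1 1 2 erefl, E 1 2 3 erefl,
  E 1 (-2) (-1) erefl, E 1 3 4 erefl, E 1 (-3) (-2) erefl, E 1 4 5 erefl, E 1 (-4) (-3) erefl,
  E 1 5 6 erefl, E 1 (-5) (-4) erefl, E (-1) (-1) (-2) erefl, E (-1) 2 1 erefl,
  E (-1) (-2) (-3) erefl, E (-1) 3 2 erefl, E (-1) (-3) (-4) erefl, E (-1) 4 3 erefl,
  E (-1) (-4) (-5) erefl, E (-1) 5 4 erefl, E (-1) (-5) (-6) erefl, E (-1) 10 9 erefl).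
case: a => [|[|[|[|[|[|[|[|a]]]]]]]] // _;
  rewrite ?(one_plus_Y1, one_plus_Y2, one_plus_Y3, one_plus_Y4, one_plus_Y5, one_plus_Y6,
  one_plus_Y7) /= ?E.
(* Node 1 is the case with surplus phi; they cancel against halves of the outer T0, and the other
   halves form T0 n. *)
- have -> : phi (n + 1 + 10) = phi (n - 9) by rewrite -[RHS]phi_per; congr phi; ring.
  have -> : T0 (n + 6) = phi (n + 9) * phi (n + 3) by rewrite /T0; congr (phi _ * phi _); ring.
  have -> : T0 (n - 6) = phi (n - 3) * phi (n - 9) by rewrite /T0; congr (phi _ * phi _); ring.
  rewrite [T0 n]/T0; field; rewrite !T0_neq0 !phi_neq0 //.
all: by field; rewrite !T0_neq0.
Qed.

End TSystem.

End E7.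

(** * The E6 T-system *)

Module E6.
Section TSystem.
Variables (F : fieldType) (phi T1 t : int -> F).
Hypothesis phi_neq0 : forall n, phi n != 0.

Definition T0 n := phi (n + 2) * phi (n - 2).

(* A point n stands for a shift by n i/4 and the period is 14.  Consecutive k
   are two chain steps (8 points) apart: seven chain steps multiply S by a
   constant, so the even ones already determine all of S and R. *)
Record lattice (c : int) := Lattice {
  S : nat -> F; R : nat -> F;
  R_neq0 : forall k, R k != 0;
  S_anti : forall k, S (k + 7)%N = - S k;
  R_anti : forall k, R (k + 7)%N = - R k;
  S_rel : S 0 * S 4 = S 0 * S 3 + S 1 * S 4 - S 1 * S 5 + S 2 * S 5 - S 2 * S 6 + S 3 * S 6;
  phiE : forall k z n, n = c + 8 * k%:Z + 14 * z ->
    phi n = (S (k + 4)%N - S (k + 3)%N) * R (k + 3)%N * R (k + 4)%N / R k;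
  tE : forall k z n, n = c + 8 * k%:Z - 7 + 14 * z -> t n = S k * R k;
  T1E : forall k z n, n = c + 8 * k%:Z + 10 + 14 * z ->
    T1 n = - (R k * R (k + 6)%N * ((S (k + 1)%N - S k) * (S (k + 5)%N - S (k + 4)%N)
      + (S (k + 1)%N - S k) * (S (k + 6)%N - S (k + 5)%N)
      + (S (k + 2)%N - S (k + 1)%N) * (S (k + 6)%N - S (k + 5)%N))) }.

Hypothesis lat : forall c, lattice c.

Ltac normalize_indices l := rewrite /= ?(S_anti l 0) ?(S_anti l 1) ?(S_anti l 2) ?(S_anti l 3)
  ?(S_anti l 4)
  ?(S_anti l 5) ?(S_anti l 6)
  ?(R_anti l 0) ?(R_anti l 1) ?(R_anti l 2) ?(R_anti l 3) ?(R_anti l 4)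
  ?(R_anti l 5) ?(R_anti l 6).

Definition T2 n := t (n - 1) * t (n + 1) - T0 n.

Definition T3 n := (T1 (n - 1) * T1 (n + 1) - T0 (n - 3) * T0 (n + 3)) / phi (n + 7).

(** The arm of node 6, which defines T3 through T1, meets the arms of nodes 1 and 5, where T3 is a
    continuant in t. *)
Lemma T3E n : T3 n = t (n - 2) * t n * t (n + 2) - T0 (n - 1) * t (n + 2)
  - T0 (n + 1) * t (n - 2).
Proof.
have l := lat (n - 1).
rewrite /T3 /T0.
index_to (n - 3 - 2) (n - 5). index_to (n - 3 + 2) (n - 1). index_to (n + 3 - 2) (n + 1).
index_to (n + 3 + 2) (n + 5).
index_to (n - 1 - 2) (n - 3). index_to (n - 1 + 2) (n + 1). index_to (n + 1 - 2) (n - 1).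
index_to (n + 1 + 2) (n + 3).
move: (phi_neq0 (n + 7)).
rewrite (@phiE _ l 1 0 (n + 7)); last lia.
rewrite (@phiE _ l 6 (-3) (n + 5)); last lia.
rewrite (@phiE _ l 3 (-2) (n - 5)); last lia.
rewrite (@phiE _ l 2 (-1) (n + 1)); last lia.
rewrite (@phiE _ l 0 0 (n - 1)); last lia.
rewrite (@phiE _ l 4 (-2) (n + 3)); last lia.
rewrite (@phiE _ l 5 (-3) (n - 3)); last lia.
rewrite (@tE _ l 1 0 n); last lia.
rewrite (@tE _ l 3 (-1) (n + 2)); last lia.
rewrite (@tE _ l 6 (-3) (n - 2)); last lia.
rewrite (@T1E _ l 6 (-4) (n + 1)); last lia.
rewrite (@T1E _ l 4 (-3) (n - 1)); last lia.
move: (S_rel l); normalize_indices l => E p.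
have {p} : S l 5 - S l 4 != 0 by move: p; rewrite !mulf_eq0 !negb_or =>
  /andP[/andP[/andP[-> _] _] _].
by move=> p; field: E; rewrite ?p ?oppr_eq0 ?R_neq0.
Qed.

(** The trivalent node mixes t with T1, so the identity is not formal in continuants and is verified
    in the S_k. *)
Lemma rel_T3 n : T3 (n + 1) * T3 (n - 1) = T0 n * (T0 (n + 2) * T0 (n - 2)) + T2 n ^+ 2 * T1 n.
Proof.
have l := lat n.
rewrite !T3E.
index_to (n + 1 - 2) (n - 1). index_to (n - 1 - 2) (n - 3). index_to (n + 1 + 2) (n + 3).
index_to (n - 1 + 2) (n + 1).
index_to (n + 1 - 1) n. index_to (n - 1 + 1) n. index_to (n + 1 + 1) (n + 2).
index_to (n - 1 - 1) (n - 2).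
rewrite /T2 /T0.
index_to (n + 2 + 2) (n + 4). index_to (n + 2 - 2) n. index_to (n - 2 + 2) n.
  index_to (n - 2 - 2) (n - 4).
rewrite (@phiE _ l 3 (-2) (n - 4)); last lia.
rewrite (@phiE _ l 5 (-3) (n - 2)); last lia.
rewrite (@phiE _ l 0 0 n); last lia.
rewrite (@phiE _ l 2 (-1) (n + 2)); last lia.
rewrite (@phiE _ l 4 (-2) (n + 4)); last lia.
rewrite (@tE _ l 4 (-2) (n - 3)); last lia.
rewrite (@tE _ l 6 (-3) (n - 1)); last lia.
rewrite (@tE _ l 1 0 (n + 1)); last lia.
rewrite (@tE _ l 3 (-1) (n + 3)); last lia.
rewrite (@T1E _ l 4 (-3) n); last lia.
move: (S_rel l); normalize_indices l => E.
by field: E; rewrite ?oppr_eq0 ?R_neq0.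
Qed.

Lemma rel_T2 n : T2 (n + 1) * T2 (n - 1) = T0 (n + 1) * T0 (n - 1) + t n * T3 n.
Proof.
rewrite T3E /T2.
index_to (n + 1 - 1) n. index_to (n - 1 + 1) n. index_to (n + 1 + 1) (n + 2).
index_to (n - 1 - 1) (n - 2).
ring.
Qed.

Hypothesis phi_per : forall n, phi (n + 14) = phi n.

Definition Y (a : nat) (n : int) : F :=
  match a with
  | 1%N | 5%N => T2 n / T0 n
  | 2%N | 4%N => t n * T3 n / (T0 (n + 1) * T0 (n - 1))
  | 3%N => T2 n ^+ 2 * T1 n / (T0 n * (T0 (n + 2) * T0 (n - 2)))
  | 6%N => phi (n + 7) * T3 n / (T0 (n + 3) * T0 (n - 3))
  | _ => 0
  end.

Lemma T0_neq0 n : T0 n != 0. Proof. by rewrite mulf_neq0. Qed.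

Lemma one_plus_Y1 n : 1 + Y 1 n = t (n + 1) * t (n - 1) / T0 n.
Proof. by rewrite /= /T2; field; rewrite T0_neq0. Qed.
Lemma one_plus_Y2 n : 1 + Y 2 n = T2 (n + 1) * T2 (n - 1) / (T0 (n + 1) * T0 (n - 1)).
Proof. by rewrite rel_T2 /=; field; rewrite !T0_neq0. Qed.
Lemma one_plus_Y3 n : 1 + Y 3 n = T3 (n + 1) * T3 (n - 1) / (T0 n * (T0 (n + 2) * T0 (n - 2))).
Proof. by rewrite rel_T3 /=; field; rewrite !T0_neq0. Qed.
Lemma one_plus_Y6 n : 1 + Y 6 n = T1 (n + 1) * T1 (n - 1) / (T0 (n + 3) * T0 (n - 3)).
Proof. by rewrite /= /T3; field; rewrite !T0_neq0 phi_neq0. Qed.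

Lemma Y_system a n : (1 <= a <= 6)%N ->
  Y a (n - 1) * Y a (n + 1) =
    match a with
    | 1%N | 5%N => 1 + Y 2 n
    | 2%N | 4%N => (1 + Y 1 n) * (1 + Y 3 n)
    | 3%N => (1 + Y 2 n) * (1 + Y 2 n) * (1 + Y 6 n)
    | _ => 1 + Y 3 n
    end.
Proof.
have E i j k : i + j = k -> n + i + j = n + k by move=> <-; rewrite addrA.
have {}E := (addrK 1 n : n + 1 - 1 = n, subrK 1 n : n - 1 + 1 = n, E 1 1 2 erefl, E 1 2 3 erefl,
  E 1 (-2) (-1) erefl, E 1 3 4 erefl, E 1 (-3) (-2) erefl, E (-1) (-1) (-2) erefl,
  E (-1) 2 1 erefl, E (-1) (-2) (-3) erefl, E (-1) 3 2 erefl, E (-1) (-3) (-4) erefl,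
  E (-1) 7 6 erefl).
case: a => [|[|[|[|[|[|[|a]]]]]]] // _;
  rewrite ?(one_plus_Y1, one_plus_Y2, one_plus_Y3, one_plus_Y6) /= ?E.
6: {
  have -> : phi (n + 1 + 7) = phi (n - 6) by rewrite -[RHS]phi_per; congr phi; ring.
  have -> : T0 (n + 4) = phi (n + 6) * phi (n + 2) by rewrite /T0; congr (phi _ * phi _); ring.
  have -> : T0 (n - 4) = phi (n - 2) * phi (n - 6) by rewrite /T0; congr (phi _ * phi _); ring.
  rewrite [T0 n]/T0; field; rewrite !T0_neq0 !phi_neq0 //. }
all: by field; rewrite !T0_neq0.
Qed.

End TSystem.

End E6.

(** * The lattice data of the E7 system, for L = 4 *)

Section E7Lattice.
Variables (F : fieldType) (v sq2 : F) (phi q : int -> F) (Trow : nat -> int -> F).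
Hypothesis two_neq0 : 2 != 0 :> F.
Hypothesis v_neq0 : v != 0.
Hypothesis v_anti : v ^+ 10 = - 1.
Hypothesis sq2E : sq2 ^+ 2 = 2.
Hypothesis phi_per : forall n z, phi (n + 20 * z) = phi n.
Hypothesis q_per : forall n z, q (n + 20 * z) = q n.
Hypothesis phi_neq0 : forall n, phi n != 0.
Hypothesis q_neq0 : forall n, q n != 0.
Hypothesis Trow_per : forall m n z, Trow m (n + 20 * z) = Trow m n.
Hypothesis Trow_closed : forall c m, (0 < m)%N -> Trow m (c + 3 * (2 * m%:Z + 3)) =
  chain_Q 3 v q c 0 * chain_Q 3 v q c m.*2.+3
  * \sum_(b < m.+1) (\sum_(a < b.+1) chain_link 3 v phi q c a.*2)
    * chain_link 3 v phi q c b.*2.+1.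
Hypothesis Trow9 : forall n, Trow 9 n = 0.

Definition spinor4 n := sq2^-1 *
 ((v ^+ 2) ^+ 2 * phi (n + 4) * (q (n + 4) / q (n - 2))
 + v ^+ 2 * phi (n - 8) * (q (n - 8) * q (n + 10) / (q (n - 2) * q (n + 6)))
 + phi n * (q (n + 10) * q n / (q (n + 6) * q (n - 6)))
 + (v ^+ 2)^-1 * phi (n + 8) * (q (n + 8) * q (n - 10) / (q (n + 2) * q (n - 6)))
 + (v ^+ 2) ^- 2 * phi (n - 4) * (q (n - 4) / q (n + 2))).

Local Notation R := (chain_Q 3 v q).
Local Notation S := (chain_S 3 5 v phi q).
Let eP : 2 * 3 * (5.*2)%:Z = 20 * 3. Proof. by []. Qed.

(** In the closed form of T_9 the terms with the constant factor S_k telescope to S_{k+21} - S_{k+1}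
    = 0. The rest runs over two antiperiods, so it is twice the alternating sum, and the R are
    nonzero. *)
Lemma Trow9_relation c k : S c k * S c (k + 9)%N =
     - S c k * S c k.+1 + S c k.+1 * S c k.+2 - S c k.+2 * S c k.+3 + S c k.+3 * S c k.+4
     - S c k.+4 * S c (k + 5)%N + S c (k + 5)%N * S c (k + 6)%N - S c (k + 6)%N * S c (k + 7)%N
     + S c (k + 7)%N * S c (k + 8)%N - S c (k + 8)%N * S c (k + 9)%N.
Proof.
have := row_chain (h := 5) two_neq0 v_neq0 v_anti eP phi_per q_per q_neq0 Trow_per Trow_closed
  (c := c) (m := 9) (k := k) (z := 0) isT erefl.
rewrite Trow9 => /esym /eqP; rewrite mulf_eq0 mulf_eq0
  !(negbTE (chain_Q_neq0 _ v_neq0 q_neq0 _ _)) /=.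
rewrite !big_ord_recr big_ord0 /= add0r.
have anti i : S c (k + i.+4.+4.+2)%N = - S c (k + i)%N.
  have -> : (k + i.+4.+4.+2 = k + i + 5.*2)%N by lia.
  exact: (chain_S_anti (h := 5) v_neq0 v_anti eP phi_per q_per q_neq0).
rewrite !anti ?addn0 -(addn4 k) -(addn3 k) -(addn2 k) -(addn1 k) => /eqP H.
apply: (mulfI two_neq0); apply/eqP; rewrite -subr_eq0; apply/eqP; apply: etrans H.
ring.
Qed.

(** The five terms of [spinor4] are proportional to the five links in [chain_S]. Since v^-5 = - v^5,
    the powers of w and the factor 1/sqrt 2 combine with -1/2 to sqrt 2 times v^5. *)
Lemma spinor4E c k z n : n = c + 6 * k%:Z - 10 + 20 * z ->
  spinor4 n = sq2 * v ^+ 5 * S c k * R c k.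
Proof.
move=> nE.
have qE i z' m : m = c + 6 * (k + i)%N%:Z + 20 * z' -> q m = v ^+ k * v ^+ i * R c (k + i)%N.
  by move=> ->; rewrite q_per -exprD /chain_Q mulVKf ?expf_neq0.
have phE i z' m : m = c + 6 * (k + i)%N%:Z + 20 * z' -> phi m = chain_phi 3 phi c (k + i)%N.
  by move=> ->; rewrite phi_per.
rewrite /spinor4.
rewrite (@qE 9 (z - 3) (n + 4)); last lia.
rewrite (@qE 8 (z - 3) (n - 2)); last lia.
rewrite (@qE 7 (z - 3) (n - 8)); last lia.
rewrite (@qE 6 (z - 2) (n + 6)); last lia.
rewrite (@qE 5 (z - 2) n); last lia.
rewrite (@qE 4 (z - 2) (n - 6)); last lia.
rewrite (@qE 3 (z - 1) (n + 8)); last lia.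
rewrite (@qE 2 (z - 1) (n + 2)); last lia.
rewrite (@qE 1 (z - 1) (n - 4)); last lia.
rewrite (@qE 0 z (n + 10)); last lia.
rewrite (@qE 0 (z - 1) (n - 10)); last lia.
rewrite (@phE 9 (z - 3) (n + 4)); last lia.
rewrite (@phE 7 (z - 3) (n - 8)); last lia.
rewrite (@phE 5 (z - 2) n); last lia.
rewrite (@phE 3 (z - 1) (n + 8)); last lia.
rewrite (@phE 1 (z - 1) (n - 4)); last lia.
have Rz i : R c (k + i)%N != 0 by rewrite chain_Q_neq0.
have R10 : R c (k + 4.*2.+2)%N = - R c k by rewrite -(chain_Q_anti (h := 5) v_anti eP q_per).
rewrite /chain_S !big_ord_recr big_ord0 /= add0r /chain_link /link -!addnS ?addn0 R10.
have Rk : R c k != 0 by rewrite chain_Q_neq0.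
have sq2_neq0 : sq2 != 0 by apply: contraNneq two_neq0 => s0; rewrite -sq2E s0 expr0n.
have s2 : sq2 * sq2 = 2 by rewrite -expr2.
by field: v_anti s2; rewrite !(Rz, Rk, sq2_neq0, expf_neq0, two_neq0, v_neq0, oppr_eq0).
Qed.

Lemma E7_lattice c : E7.lattice (sq2 * v ^+ 5) phi (Trow 1) (fun n => Trow 2 (n + 10)) spinor4 c.
Proof.
have T1 := row_chain (h := 5) two_neq0 v_neq0 v_anti eP phi_per q_per q_neq0 Trow_per Trow_closed.
exists (S c) (R c).
- by move=> k; exact: chain_Q_neq0.
- by move=> k; rewrite -(chain_S_anti (h := 5) v_neq0 v_anti eP phi_per q_per q_neq0).
- by move=> k; rewrite -(chain_Q_anti (h := 5) v_anti eP q_per).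
- exact: Trow9_relation.
- move=> k z n nE; apply: (phi_chain (h := 5) two_neq0 v_neq0 v_anti eP phi_per q_per q_neq0
    (z := z)).
  by rewrite nE; ring.
- by move=> k z n; apply: spinor4E.
- move=> k z n nE; rewrite (T1 c 1%N k z n isT); last by rewrite nE; ring.
  rewrite !big_ord_recr big_ord0 /= add0r -(addn4 k) -(addn3 k) -(addn2 k) -(addn1 k).
  ring.
- move=> k z n nE; rewrite (T1 c 2%N k z (n + 10) isT); last by rewrite nE; ring.
  rewrite !big_ord_recr big_ord0 /= add0r -(addn4 k) -(addn3 k) -(addn2 k) -(addn1 k).
  ring.
Qed.

End E7Lattice.

(** * The lattice data of the E6 system, for L = 6 *)

Section E6Lattice.
Variables (F : fieldType) (v : F) (phi q : int -> F) (Trow : nat -> int -> F).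
Hypothesis two_neq0 : 2 != 0 :> F.
Hypothesis v_neq0 : v != 0.
Hypothesis v_anti : v ^+ 14 = - 1.
Hypothesis phi_per : forall n z, phi (n + 14 * z) = phi n.
Hypothesis q_per : forall n z, q (n + 14 * z) = q n.
Hypothesis phi_neq0 : forall n, phi n != 0.
Hypothesis q_neq0 : forall n, q n != 0.
Hypothesis Trow_per : forall m n z, Trow m (n + 14 * z) = Trow m n.
Hypothesis Trow_closed : forall c m, (0 < m)%N -> Trow m (c + 2 * (2 * m%:Z + 3)) =
  chain_Q 2 v q c 0 * chain_Q 2 v q c m.*2.+3
  * \sum_(b < m.+1) (\sum_(a < b.+1) chain_link 2 v phi q c a.*2)
    * chain_link 2 v phi q c b.*2.+1.
Hypothesis Trow13 : forall n, Trow 13 n = 0.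

Definition spinor6 n := 2^-1 *
 ((v ^+ 2) ^+ 3 * phi (n + 3) * (q (n + 3) / q (n - 1))
 + (v ^+ 2) ^+ 2 * phi (n - 5) * (q (n - 5) * q (n - 7) / (q (n - 1) * q (n + 5)))
 + v ^+ 2 * phi (n + 1) * (q (n + 1) * q (n - 7) / (q (n - 3) * q (n + 5)))
 + phi (n - 7) * (q (n - 7) ^+ 2 / (q (n - 3) * q (n + 3)))
 + (v ^+ 2)^-1 * phi (n - 1) * (q (n - 1) * q (n + 7) / (q (n + 3) * q (n - 5)))
 + (v ^+ 2) ^- 2 * phi (n + 5) * (q (n + 5) * q (n + 7) / (q (n + 1) * q (n - 5)))
 + (v ^+ 2) ^- 3 * phi (n - 3) * (q (n - 3) / q (n + 1))).

Local Notation R := (chain_Q 2 v q).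
Local Notation S := (chain_S 2 7 v phi q).
Let eP : 2 * 2 * (7.*2)%:Z = 14 * 4. Proof. by []. Qed.

(** The factor v^7 is chosen so that [spinor6] becomes the plain product of [even_S] and
    [even_Q]. *)
Definition even_S c j := v ^+ 7 * S c j.*2.
Definition even_Q c j := R c j.*2.

Let v7 : v ^+ 7 * v ^+ 7 = -1. Proof. by rewrite -exprD. Qed.
Let R_nz c k : R c k != 0. Proof. by rewrite chain_Q_neq0. Qed.

(** Seven chain steps are 28 points, two full periods, so only the rescaling changes: v^-7 = -
    v^7. *)
Lemma chain_Q7 c k : R c (k + 7)%N = - v ^+ 7 * R c k.
Proof.
rewrite /chain_Q (_ : c + _ = c + 2 * 2 * k%:Z + 14 * 2); last by rewrite PoszD; ring.
by rewrite q_per exprD; field: v_anti; rewrite !expf_neq0.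
Qed.

Lemma chain_phi7 c k : chain_phi 2 phi c (k + 7)%N = chain_phi 2 phi c k.
Proof.
by rewrite /chain_phi (_ : c + _ = c + 2 * 2 * k%:Z + 14 * 2) ?phi_per // PoszD; ring.
Qed.

Lemma chain_link7 c k : chain_link 2 v phi q c (k + 7)%N = v ^+ 7 * chain_link 2 v phi q c k.
Proof.
rewrite /chain_link /link -!addSn !chain_Q7 chain_phi7; field: v7.
by rewrite !(R_nz, expf_neq0, v_neq0, oppr_eq0).
Qed.

Lemma chain_S7 c k : S c (k + 7)%N = v ^+ 7 * S c k.
Proof.
rewrite /chain_S mulrCA; congr (_ * _); rewrite mulr_sumr.
by apply: eq_bigr => i _; rewrite addnAC chain_link7.
Qed.

Lemma chain_S_even c j : S c j.*2 = - v ^+ 7 * even_S c j.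
Proof. by rewrite /even_S mulrA mulNr v7 opprK mul1r. Qed.

(** Seven steps change the parity of the index: 2j + 1 + 7 = 2(j + 4). *)
Lemma chain_S_odd c j : S c j.*2.+1 = - even_S c (j + 4)%N.
Proof.
rewrite /even_S doubleD -[4.*2]/(1 + 7)%N addnA addn1 chain_S7 mulrA v7 mulN1r opprK //.
Qed.

Lemma even_S_anti c j : even_S c (j + 7)%N = - even_S c j.
Proof.
by rewrite /even_S doubleD (chain_S_anti (h := 7) v_neq0 v_anti eP phi_per q_per q_neq0) mulrN.
Qed.

Lemma even_Q_anti c j : even_Q c (j + 7)%N = - even_Q c j.
Proof. by rewrite /even_Q doubleD (chain_Q_anti (h := 7) v_anti eP q_per). Qed.

Lemma spinor6E c k z n : n = c + 8 * k%:Z - 7 + 14 * z -> spinor6 n = even_S c k * even_Q c k.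
Proof.
move=> nE.
have qE i z' m : m = c + 4 * (k.*2 + i)%N%:Z + 14 * z' ->
  q m = v ^+ k.*2 * v ^+ i * R c (k.*2 + i)%N.
  by move=> ->; rewrite q_per -exprD /chain_Q mulVKf ?expf_neq0.
have phE i z' m : m = c + 4 * (k.*2 + i)%N%:Z + 14 * z' -> phi m = chain_phi 2 phi c (k.*2 + i)%N.
  by move=> ->; rewrite phi_per.
rewrite /spinor6.
rewrite (@qE 0 z (n + 7)); last lia.
rewrite (@qE 0 (z - 1) (n - 7)); last lia.
rewrite (@qE 6%N (z - 2) (n + 3)); last lia.
rewrite (@qE 5%N (z - 2) (n - 1)); last lia.
rewrite (@qE 4%N (z - 2) (n - 5)); last lia.
rewrite (@qE 3%N (z - 1) (n + 5)); last lia.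
rewrite (@qE 2%N (z - 1) (n + 1)); last lia.
rewrite (@qE 1%N (z - 1) (n - 3)); last lia.
rewrite (@phE 0 (z - 1) (n - 7)); last lia.
rewrite (@phE 6%N (z - 2) (n + 3)); last lia.
rewrite (@phE 5%N (z - 2) (n - 1)); last lia.
rewrite (@phE 4%N (z - 2) (n - 5)); last lia.
rewrite (@phE 3%N (z - 1) (n + 5)); last lia.
rewrite (@phE 2%N (z - 1) (n + 1)); last lia.
rewrite (@phE 1%N (z - 1) (n - 3)); last lia.
have R14 : R c (k.*2 + 6.*2.+2)%N = - R c k.*2
  by rewrite -(chain_Q_anti (h := 7) v_anti eP q_per).
have R7 i : R c (k.*2 + i.+4.+3)%N = - v ^+ 7 * R c (k.*2 + i)%N
  by rewrite -chain_Q7 -addnA !addnS !addn0.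
have ph7 i : chain_phi 2 phi c (k.*2 + i.+4.+3)%N = chain_phi 2 phi c (k.*2 + i)%N
  by rewrite -[RHS]chain_phi7 -addnA !addnS !addn0.
rewrite /even_S /even_Q /chain_S !big_ord_recr big_ord0 /= add0r /chain_link /link -!addnS
  ?addn0 R14.
rewrite !R7 !ph7 ?addn0.
by field: v_anti; rewrite !(R_nz, expf_neq0, two_neq0, v_neq0, oppr_eq0).
Qed.

(** Writing E for [even_S], the vanishing of T_13 gives the sum of E_j (E_{j+4} - E_{j+3}) over 14
    values of j. This is two antiperiods, and E_{j+4} E_{j+7} = - E_j E_{j+4} makes both halves of
    the bracket contribute equally; hence the factor 4. *)
Lemma Trow13_relation c : even_S c 0 * even_S c 4 = even_S c 0 * even_S c 3
  + even_S c 1 * even_S c 4 - even_S c 1 * even_S c 5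
  + even_S c 2 * even_S c 5 - even_S c 2 * even_S c 6 + even_S c 3 * even_S c 6.
Proof.
have := @row_chain _ _ _ _ 7 _ _ _ _ two_neq0 v_neq0 v_anti eP phi_per q_per q_neq0 Trow_per
  Trow_closed c 13 0 0 _ isT erefl.
rewrite Trow13 => /esym /eqP; rewrite mulf_eq0 mulf_eq0 !(negbTE (R_nz _ _)) /=.
under eq_bigr => b _ do rewrite !add0n -doubleS -[0%N]/(0.*2) !chain_S_even !chain_S_odd.
rewrite !big_ord_recr big_ord0 /= add0r.
have anti i : even_S c i.+4.+3 = - even_S c i by rewrite -even_S_anti !addnS addn0.
rewrite !anti => /eqP H.
have four_neq0 : 4 * v ^+ 7 != 0 by rewrite !mulf_neq0 ?expf_neq0 // (natrM _ 2 2) mulf_neq0.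
apply: (mulfI four_neq0); apply/eqP; rewrite -subr_eq0; apply/eqP; apply: etrans H.
ring.
Qed.

Lemma E6_lattice c : E6.lattice phi (Trow 1) spinor6 c.
Proof.
have T1 := row_chain (h := 7) two_neq0 v_neq0 v_anti eP phi_per q_per q_neq0 Trow_per Trow_closed.
exists (even_S c) (even_Q c).
- by move=> k; exact: R_nz.
- exact: even_S_anti.
- exact: even_Q_anti.
- exact: Trow13_relation.
(* The point c + 8k is reached two periods later as chain point 2k + 7, which lies between the even
   points 2(k + 3) and 2(k + 4). *)
- move=> k z n nE; rewrite (@phi_chain _ 2 14 4 7 v phi q two_neq0 v_neq0 v_anti eP phi_per q_per
    q_neq0 c (k + 3).*2 (z - 2)); last by rewrite nE -muln2; lia.
  rewrite -doubleS -addnS !chain_S_even /even_Q.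
  have -> : R c (k + 3).*2.+1 = - v ^+ 7 * R c k.*2 by rewrite -chain_Q7 doubleD -addnS.
  by field: v7; rewrite !(R_nz, expf_neq0, v_neq0, oppr_eq0).
- by move=> k z n; apply: spinor6E.
- move=> k z n nE; rewrite (@T1 c 1%N k.*2 z n isT); last by rewrite nE -muln2; lia.
  rewrite !big_ord_recr big_ord0 /= add0r double0 -[1.*2]/2%N !addnS !addn0 -!doubleS !chain_S_odd
    !chain_S_even /even_Q.
  have -> : R c k.+2.*2.+1 = v ^+ 7 * R c (k + 6).*2.
    rewrite (_ : (k + 6).*2 = k.+2.*2.+1 + 7)%N; last by rewrite -!muln2; lia.
    by rewrite chain_Q7 mulrA mulrN v7 opprK mul1r.
  rewrite ?addSn !addnS !addn0.
  ring: v7.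
Qed.

End E6Lattice.

(** * Zeros of the theta function *)

Section ComplexLimits.
Variable R : realType.
Implicit Types (z : R[i]) (f : nat -> R[i]).

Lemma normcC (x : R) : `|x%:C| = `|x|%:C :> R[i].
Proof. by rewrite normc_def /= expr0n addr0 sqrtr_sqr. Qed.

(** The norm of [R[i]] takes values in [R[i]]; its real part allows estimates in the ordered field
    R. *)
Definition nrm z : R := complex.Re `|z|.

Lemma nrmE z : `|z| = (nrm z)%:C.
Proof. by rewrite /nrm normc_def. Qed.

Lemma nrmD z z' : nrm (z + z') <= nrm z + nrm z'.
Proof. by rewrite -lecR rmorphD /= -!nrmE ler_normD. Qed.

Lemma nrmM z z' : nrm (z * z') = nrm z * nrm z'.
Proof. by apply: complexI; rewrite rmorphM /= -!nrmE normrM. Qed.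

Lemma nrm_ge0 z : 0 <= nrm z.
Proof. by rewrite -ler0c -nrmE normr_ge0. Qed.

Lemma nrm_eq0 z : (nrm z == 0) = (z == 0).
Proof. by rewrite -(inj_eq (@complexI R)) -nrmE rmorph0 normr_eq0. Qed.

Lemma nrm_Re z : `|complex.Re z| <= nrm z.
Proof. by rewrite -lecR -nrmE normc_ge_Re. Qed.

Lemma nrm_Im z : `|complex.Im z| <= nrm z.
Proof.
have := nrm_Re (z * 'i%C); rewrite ReiNIm normrN nrmM.
have -> : nrm 'i%C = 1 :> R by rewrite /nrm normc_def /= expr0n expr1n add0r sqrtr1.
by rewrite mulr1.
Qed.

Lemma nrm_ReIm z : nrm z <= `|complex.Re z| + `|complex.Im z|.
Proof.
rewrite {1}[z]complexE; apply: le_trans (nrmD _ _) _; rewrite nrmM.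
have -> : nrm 'i%C = 1 :> R by rewrite /nrm normc_def /= expr0n expr1n add0r sqrtr1.
by rewrite mul1r /nrm !normcC.
Qed.

Lemma cvgC_dist f l : f @ \oo --> l <-> forall e : R, 0 < e -> \forall n \near \oo,
  nrm (l - f n) < e.
Proof.
split=> [/cvgrPdist_lt H e e0|H].
  have := H e%:C; rewrite ltcR => /(_ e0); apply: filterS => n /=.
  by rewrite nrmE ltcR.
apply/cvgrPdist_lt => e e0.
have eE : e = (complex.Re e)%:C by move: e0; case: e => a b; rewrite ltcE /= => /andP[/eqP ->].
move: e0; rewrite eE ltcR => e0; have := H _ e0; apply: filterS => n.
by rewrite nrmE ltcR.
Qed.

Lemma near_dnbhsP z (P : R[i] -> Prop) : (\forall x \near z^', P x) <->
  exists2 e : R, 0 < e & forall x, nrm (x - z) < e -> x != z -> P x.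
Proof.
split=> [/nbhs_normP[e /= e0 H]|[e e0 H]].
  have eE : e = (complex.Re e)%:C by move: e0; case: e {H} => a b; rewrite ltcE /= =>
    /andP[/eqP ->].
  move: e0 H; rewrite eE ltcR => e0 H; exists (complex.Re e) => // x xz x_neq; apply: H => //=.
  by rewrite distrC nrmE ltcR.
apply/nbhs_normP; exists e%:C => /=; first by rewrite ltcR.
by move=> x /=; rewrite distrC nrmE ltcR; exact: H.
Qed.

Lemma geometric_increments_cvg (u : nat -> R) C r : 0 <= r < 1 ->
  (forall k, `|u k.+1 - u k| <= C * r ^+ k) -> cvgn u.
Proof.
move=> /andP[r0 r1] H.
have : cvgn (series (telescope u)).
  apply: normed_cvg; apply: (@series_le_cvg _ _ (geometric C r)) => [n|n|n|].
  - exact: normr_ge0.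
  - exact: le_trans (H n).
  - exact: H.
  - by apply: is_cvg_geometric_series; rewrite ger0_norm.
rewrite telescopeK => Hc.
have -> : u = (fun n => (u n - u 0%N) + u 0%N) by apply/funext => n; rewrite subrK.
by apply: is_cvgD => //; exact: is_cvg_cst.
Qed.

Lemma complex_geometric_increments_cvg (g : nat -> R[i]) C r : 0 <= r < 1 ->
  (forall k, nrm (g k.+1 - g k) <= C * r ^+ k) -> exists l : R[i], g @ \oo --> l.
Proof.
move=> r01 H.
have Rc : cvgn (fun k => complex.Re (g k)).
  apply: (geometric_increments_cvg r01 (C := C)) => k; apply: le_trans (H k).
  by rewrite -raddfB nrm_Re.
have Ic : cvgn (fun k => complex.Im (g k)).
  apply: (geometric_increments_cvg r01 (C := C)) => k; apply: le_trans (H k).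
  by rewrite -raddfB nrm_Im.
exists (lim ((fun k => complex.Re (g k)) @ \oo) +i* lim ((fun k => complex.Im (g k)) @ \oo)).
apply/cvgC_dist => e e0; have e20 : 0 < e / 2 by rewrite divr_gt0.
move/cvgrPdist_lt/(_ _ e20) : Rc; move/cvgrPdist_lt/(_ _ e20) : Ic => HI HR.
near=> n; apply: le_lt_trans (nrm_ReIm _) _; rewrite [e]splitr.
by rewrite raddfB [complex.Im (_ - _)]raddfB /= ltrD //; near: n.
Unshelve. all: by end_near. Qed.

(** A finite head is split off so that all partial products g of the tail stay within 1/2 of 1. They
    are then bounded by 2, which makes their increments geometric, and their limit cannot be 0. *)
Lemma infinite_product (f : nat -> R[i]) C r : 0 <= C -> 0 <= r < 1 ->
  (forall n, nrm (f n - 1) <= C * r ^+ n) ->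
  exists2 l : R[i], (fun m => \prod_(1 <= n < m.+1) f n) @ \oo --> l &
    (forall n, (0 < n)%N -> f n != 0) -> l != 0.
Proof.
move=> C0 /andP[r0 r1] H; have r10 : 0 < 1 - r by rewrite subr_gt0.
have [N HN] : exists N, 2 * (C / (1 - r)) * r ^+ N.+1 <= 1 / 2.
  have e0 : 0 < (1 - r) / (4 * (C + 1)) by rewrite divr_gt0 // mulr_gt0 // ltr_wpDl.
  have := cvg_expr (z := r); rewrite ger0_norm // => /(_ r1) /cvgrPdist_lt /(_ _ e0) [N _ HN].
  exists N; have := HN N.+1 (leqnSn N) => /=.
  rewrite sub0r normrN ger0_norm ?exprn_ge0 // => /ltW HN1.
  have : 2 * (C / (1 - r)) * r ^+ N.+1 <= 2 * (C / (1 - r)) * ((1 - r) / (4 * (C + 1))).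
    by rewrite ler_wpM2l // mulr_ge0 // divr_ge0 // ltW.
  move=> /le_trans; apply.
  have -> : 2 * (C / (1 - r)) * ((1 - r) / (4 * (C + 1))) = 1 / 2 * (C / (C + 1)).
    by field; rewrite !gt_eqF // ltr_wpDl.
  have C1 : C / (C + 1) <= 1 by rewrite ler_pdivrMr ?ltr_wpDl // mul1r lerDl.
  by rewrite ler_piMr // divr_ge0.
pose g k := \prod_(N.+1 <= n < N.+1 + k) f n.
have gS k : g k.+1 = g k * f (N.+1 + k)%N by rewrite /g addnS big_nat_recr //= leq_addr.
(* The sum of 2 C r^(N+1+j) over j < k, which bounds the accumulated increments of g. *)
pose B k := 2 * (C / (1 - r)) * r ^+ N.+1 * (1 - r ^+ k).
have B_le k : B k <= 1 / 2.
  apply: le_trans HN; rewrite /B ler_piMr ?gerBl ?exprn_ge0 //.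
  by rewrite !mulr_ge0 ?exprn_ge0 ?invr_ge0 // ltW.
have nrm1 : nrm 1 = 1 :> R by rewrite /nrm normr1.
have gB k : nrm (g k - 1) <= B k.
  elim: k => [|k IH].
    have /eqP -> : nrm (g 0%N - 1) == 0 by rewrite nrm_eq0 /g addn0 big_geq // subrr.
    by rewrite /B expr0 subrr mulr0.
  have -> : g k.+1 - 1 = g k * (f (N.+1 + k)%N - 1) + (g k - 1) by rewrite gS; ring.
  apply: le_trans (nrmD _ _) _; rewrite nrmM.
  have g2 : nrm (g k) <= 2.
    rewrite -[g k](subrK 1); apply: le_trans (nrmD _ _) _; rewrite nrm1.
    have := le_trans IH (B_le k); lra.
  have : nrm (g k) * nrm (f (N.+1 + k)%N - 1) <= 2 * (C * r ^+ (N.+1 + k)).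
    by rewrite ler_pM ?nrm_ge0.
  move=> /lerD /(_ IH) /le_trans; apply.
  rewrite le_eqVlt; apply/orP; left; apply/eqP; rewrite /B exprD (exprS r k).
  by field; rewrite gt_eqF.
have gg k : nrm (g k.+1 - g k) <= (2 * C) * r ^+ k.
  have -> : g k.+1 - g k = g k * (f (N.+1 + k)%N - 1) by rewrite gS; ring.
  have g2 : nrm (g k) <= 2.
    rewrite -[g k](subrK 1); apply: le_trans (nrmD _ _) _; rewrite nrm1.
    have := le_trans (gB k) (B_le k); lra.
  rewrite nrmM -mulrA ler_pM ?nrm_ge0 //; apply: le_trans (H _) _.
  rewrite ler_wpM2l // exprD ler_piMl ?exprn_ge0 //.
  by rewrite exprn_ile1 // ltW.
have r01 : 0 <= r < 1 by rewrite r0.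
have [l gl] := complex_geometric_increments_cvg r01 gg.
pose A := \prod_(1 <= n < N.+1) f n.
exists (A * l).
  apply/cvgC_dist => e e0.
  have e0' : 0 < e / (nrm A + 1) by rewrite divr_gt0 // ltr_wpDl // nrm_ge0.
  have /cvgC_dist /(_ _ e0') [M _ HM] := gl.
  exists (M + N)%N => // m /= Mm.
  have -> : \prod_(1 <= n < m.+1) f n = A * g (m - N)%N.
    rewrite /A /g (big_cat_nat (n := N.+1)) //=;
      last by rewrite ltnS (leq_trans _ Mm) // leq_addl.
    by rewrite addSn subnKC // (leq_trans _ Mm) // leq_addl.
  rewrite -mulrBr nrmM.
  have {}HM : nrm (l - g (m - N)%N) < e / (nrm A + 1).
    by apply: HM => /=; rewrite leq_subRL ?(leq_trans _ Mm) ?leq_addl // addnC.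
  rewrite ltr_pdivlMr ?ltr_wpDl ?nrm_ge0 // in HM.
  apply: le_lt_trans HM; rewrite mulrC ler_wpM2l ?nrm_ge0 // lerDl //.
move=> f0; rewrite mulf_neq0 //.
  rewrite /A prodf_seq_neq0; apply/allP => n; rewrite mem_index_iota => /andP[n0 _].
  by rewrite f0.
apply/eqP => l0; have e2 : 0 < 1 / 2 :> R by rewrite divr_gt0.
have /cvgC_dist /(_ _ e2) [M _ /(_ M (leqnn M)) /=] := gl.
rewrite l0; apply/negP; rewrite -leNgt.
have := nrmD (0 - g M) (g M - 1); have -> : 0 - g M + (g M - 1) = - 1 by ring.
have -> : nrm (-1) = 1 :> R by rewrite /nrm normrN1.
have := le_trans (gB M) (B_le M); lra.
Qed.

End ComplexLimits.

Lemma quad_factor (F : fieldType) (X Y : F) : 2 != 0 :> F -> Y != 0 ->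
  1 - 2 * X * ((Y + Y^-1) / 2) + X ^+ 2 = (1 - X * Y) * (1 - X / Y).
Proof. by move=> two0 Y0; field; rewrite Y0. Qed.

(** * Zeros and quasi-period of theta_1 *)

Section Theta.
Variable R : realType.
Implicit Types (z a b : R[i]) (tau : R).

Lemma cexpD a b : cexp (a + b) = cexp a * cexp b.
Proof.
case: a => a1 a2; case: b => b1 b2; rewrite /cexp /= expRD rmorphM /=.
rewrite cosD sinD; apply/eqP; rewrite eq_complex /=; apply/andP; split; apply/eqP; ring.
Qed.

Lemma cexp_real (x : R) : cexp (x%:C) = (expR x)%:C.
Proof. by rewrite /cexp /= cos0 sin0 mulr1. Qed.

Lemma cexp0 : cexp 0 = 1 :> R[i].
Proof. by rewrite (cexp_real 0) expR0. Qed.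

Lemma cexp_neq0 a : cexp a != 0.
Proof.
have E : cexp a * cexp (- a) = 1 by rewrite -cexpD subrr cexp0.
by apply: contraTneq (oner_neq0 R[i]) => a0; rewrite -E a0 mul0r eqxx.
Qed.

Lemma cexpN a : cexp (- a) = (cexp a)^-1.
Proof. by apply: (mulfI (cexp_neq0 a)); rewrite -cexpD subrr cexp0 mulfV ?cexp_neq0. Qed.

Lemma cexp_pi : cexp (Ci * pi%:C) = -1 :> R[i].
Proof. by rewrite /cexp /= !mul0r !mul1r subr0 add0r expR0 cospi sinpi mul1r; apply/eqP;
  rewrite eq_complex /= oppr0 !eqxx. Qed.

Lemma cexpX a n : cexp (a *+ n) = cexp a ^+ n.
Proof. by elim: n => [|n IH]; rewrite ?mulr0n ?cexp0 // mulrS cexpD IH exprS. Qed.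

Definition theta_factor tau z (n : nat) : R[i] := let q := expR (- tau) in
  (1 - 2 * q%:C ^+ (2 * n) * ccos (2 * z) + q%:C ^+ (4 * n)) * (1 - q%:C ^+ (2 * n)).

(** With x = q^(2n), a factor minus 1 equals x (-1 + x - x^2 + 2 (x - 1) cos 2z), which is geometric
    of ratio q^2. *)
Lemma theta_limit tau z : 0 < tau -> exists2 l : R[i],
  lim ((fun m : nat => \prod_(1 <= n < m.+1) theta_factor tau z n) @ \oo) = l &
  (forall n, (0 < n)%N -> theta_factor tau z n != 0) -> l != 0.
Proof.
move=> tau0; set q := expR (- tau).
have q0 : 0 <= q := expR_ge0 _.
have q1 : q < 1 by rewrite -expR0 ltr_expR oppr_lt0.
have [|||l cl lnz] := @infinite_product _ (theta_factor tau z) (3 + 4 * nrm (ccos (2 * z)))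
  (q ^+ 2).
- by rewrite addr_ge0 // mulr_ge0 // nrm_ge0.
- by rewrite exprn_ge0 //= exprn_ilt1.
- move=> n; rewrite -exprM; set x := q ^+ (2 * n).
  have x0 : 0 <= x by rewrite exprn_ge0.
  have x1 : x <= 1 by rewrite exprn_ile1 // ltW.
  rewrite /theta_factor -/q -!rmorphXn /= -/x (_ : q ^+ (4 * n) = x ^+ 2); last first.
    by rewrite /x -exprM; congr (_ ^+ _); lia.
  set c := ccos _.
  have -> : (1 - 2 * x%:C * c + (x ^+ 2)%:C) * (1 - x%:C) - 1 =
      x%:C * (((- 1 + x - x ^+ 2)%:C) + (2 * (x - 1))%:C * c).
    by rewrite !(rmorphM, rmorphD, rmorphB, rmorphN, rmorphXn, rmorph1, rmorph_nat) /=; ring.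
  rewrite nrmM mulrC; have -> : nrm x%:C = x by rewrite /nrm normcC /= ger0_norm.
  apply: ler_pM; rewrite ?nrm_ge0 //.
  apply: le_trans (nrmD _ _) _; rewrite nrmM {1 2}/nrm !normcC /=.
  apply: lerD; first by rewrite ler_norml; apply/andP; split; nra.
  by rewrite ler_wpM2r ?nrm_ge0 // ler_norml; apply/andP; split; nra.
exists l => //; apply: cvg_lim => //; exact: norm_hausdorff.
Qed.

Lemma theta1E tau z : theta1 tau z = 2 * (expR (- tau) `^ (4^-1))%:C * csin z *
  lim ((fun m : nat => \prod_(1 <= n < m.+1) theta_factor tau z n) @ \oo).
Proof. by []. Qed.

Lemma cexp_mul2 z : cexp (Ci * (2 * z)) = cexp (Ci * z) ^+ 2.
Proof. by rewrite -cexpX; congr cexp; ring. Qed.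

Lemma theta_factor_eq0 tau z n : (0 < n)%N -> 0 < tau -> theta_factor tau z n = 0 ->
  exists k : R, k \in Num.int /\ cexp (Ci * (2 * z)) = (expR (2 * tau * k))%:C.
Proof.
move=> n0 tau0; rewrite /theta_factor; set q := expR (- tau).
have E0 := cexp_neq0 (Ci * (2 * z)).
set x := q ^+ (2 * n).
have xE : x = expR (2 * tau * - n%:R).
  by rewrite /x /q -expRM_natl natrM; congr expR; ring.
have x0 : x != 0 by rewrite xE gt_eqF // expR_gt0.
have xC0 : x%:C != 0 by rewrite -(rmorph0 (real_complex R)) (inj_eq (@complexI _)).
have x1 : x < 1.
  by rewrite xE -[X in _ < X]expR0 ltr_expR mulrN oppr_lt0 mulr_gt0 ?mulr_gt0 ?ltr0n.
rewrite -!rmorphXn /= -/x (_ : q ^+ (4 * n) = x ^+ 2); last first.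
  by rewrite /x -exprM; congr (_ ^+ _); lia.
rewrite /ccos cexpN; set E := cexp _ in E0 *.
have -> : 1 - 2 * x%:C * ((E + E^-1) / 2) + (x ^+ 2)%:C = (1 - x%:C * E) * (1 - x%:C / E).
  by rewrite [(x ^+ 2)%:C]rmorphXn /= quad_factor // pnatr_eq0.
move=> /eqP; rewrite !mulf_eq0 => /orP[/orP[]|]; rewrite subr_eq0 => /eqP H.
- exists n%:R; split; first exact: natr_int.
  have -> : E = x%:C^-1 by apply: (mulfI xC0); rewrite -H mulfV.
  by rewrite -fmorphV /= xE -expRN; congr (expR _)%:C; ring.
- exists (- n%:R); split; first by rewrite rpredN natr_int.
  by rewrite -xE -[RHS](divfK E0) -H mul1r.
- by move: H => /complexI H; rewrite -H ltxx in x1.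
Qed.

(** Every vanishing factor makes exp(2iz) equal to the positive real number exp(2 tau k); its
    modulus gives Im z, its argument gives sin(Re z) = 0. *)
Lemma theta1_eq0 tau z : 0 < tau -> theta1 tau z = 0 ->
  exists k : R, [/\ k \in Num.int, complex.Im z = - tau * k & sin (complex.Re z) = 0].
Proof.
move=> tau0 z0.
have [k [kint kE]] : exists k : R, k \in Num.int /\ cexp (Ci * (2 * z)) = (expR (2 * tau * k))%:C.
  have [l lE l_neq0] := theta_limit z tau0.
  have [cs csE] : exists cs, csin z = cs by exists (csin z).
  move: z0; rewrite theta1E lE csE => /eqP.
  rewrite !mulf_eq0 pnatr_eq0 /= -!orbA => /or3P[|s0|/eqP l0].
  - by rewrite -(rmorph0 (real_complex R)) (inj_eq (@complexI _)) gt_eqF // powR_gt0 // expR_gt0.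
  - exists 0; split; first exact: int_num0.
    rewrite mulr0 expR0 cexp_mul2.
    move: s0; rewrite -csE /csin !mulf_eq0 invr_eq0 mulf_eq0 pnatr_eq0 /=.
    have -> : ('i%C == 0 :> R[i]) = false by rewrite eq_complex /= oner_eq0 andbF.
    rewrite orbF subr_eq0 cexpN => /eqP E.
    by rewrite expr2 {2}E mulfV //; exact: cexp_neq0.
  - have [n [n0 fn]] : exists n, (0 < n)%N /\ theta_factor tau z n = 0.
      apply: contrapT => H; suff : l != 0 by rewrite l0 eqxx.
      by apply: l_neq0 => n n0; apply/eqP => fn; apply: H; exists n.
    exact: theta_factor_eq0 fn.
suff [H1 H2] : complex.Im z = - tau * k /\ sin (complex.Re z) = 0 by exists k.
move: kE; case: z z0 => a b _.
have -> : Ci * (2 * (a +i* b)) = (- (2 * b)) +i* (2 * a).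
  apply/eqP; rewrite eq_complex /=; apply/andP; split; apply/eqP; ring.
rewrite /cexp /= => /eqP; rewrite eq_complex /= !(mul0r, subr0, addr0) => /andP[/eqP kR /eqP kI].
have e0 : expR (- (2 * b)) > 0 := expR_gt0 _.
have s2 : sin (2 * a) = 0 by apply: (mulfI (lt0r_neq0 e0)); rewrite mulr0.
have c_gt0 : 0 < cos (2 * a) by rewrite -(pmulr_rgt0 _ e0) kR expR_gt0.
have c1 : cos (2 * a) = 1.
  have := cos2Dsin2 (2 * a); rewrite s2 expr0n addr0 => /eqP.
  by rewrite sqrf_eq1 => /orP[/eqP //|/eqP c]; move: c_gt0; rewrite c ltr0N1.
split.
  move: kR; rewrite c1 mulr1 => /expR_inj; lra.
have := cos_mulr2n a; rewrite -(mulr_natl a) c1 -(mulr_natl (_ ^+ 2)) cos2sin2 => H.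
by apply/eqP; rewrite -sqrf_eq0; apply/eqP; lra.
Qed.

(** The spacing of the zeros is tau vertically and pi > 1 horizontally. *)
Lemma theta1_zeros_separated tau a b : 0 < tau -> theta1 tau a = 0 -> theta1 tau b = 0 ->
  nrm (a - b) < Num.min tau 1 -> a = b.
Proof.
move=> tau0 /(theta1_eq0 tau0) [k [kint aI aR]] /(theta1_eq0 tau0) [l [lint bI bR]].
rewrite lt_min => /andP[d_tau d_1].
have kl : k = l.
  have : `|complex.Im (a - b)| < tau by exact: le_lt_trans (nrm_Im _) _.
  rewrite raddfB /= aI bI -mulrBr normrM (normrN tau) (gtr0_norm tau0) => H.
  have {H} : `|k - l| < 1 by rewrite -(ltr_pM2l tau0) mulr1.
  have /intrP [m mE] := rpredB kint lint.
  rewrite mE -intr_norm -[1]/(1%:~R) ltr_int => m1.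
  have m0 : m = 0 by lia.
  by apply/eqP; rewrite -subr_eq0 mE m0.
have ReE : complex.Re a = complex.Re b.
  have : `|complex.Re (a - b)| < 1 by exact: le_lt_trans (nrm_Re _) _.
  rewrite raddfB /=; set t := _ - _; rewrite ltr_norml => /andP[t1 t2].
  have s0 : sin t = 0 by rewrite sinB aR bR !(mulr0, mul0r) subr0.
  apply/eqP; rewrite -subr_eq0 -/t; apply: contraPT s0 => t0.
  have pi1 : 1 < pi :> R by rewrite (lt_le_trans _ (pi_ge2 R)) // ltr1n.
  case: (ltrgt0P t) t0 => // ht _; apply/eqP.
    by rewrite gt_eqF // sin_gt0_pi // ht (lt_trans t2).
  rewrite -oppr_eq0 -sinN gt_eqF // sin_gt0_pi // oppr_gt0 ht (lt_trans _ pi1) //.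
  by rewrite ltrNl.
by rewrite [a]complexE [b]complexE ReE aI bI kl.
Qed.

Lemma cexpBpi z : cexp (Ci * (z - pi%:C)) = - cexp (Ci * z).
Proof. by rewrite mulrBr cexpD cexpN cexp_pi invrN1 mulrN1. Qed.

Lemma csinBpi z : csin (z - pi%:C) = - csin z.
Proof. by rewrite /csin !cexpN !cexpBpi invrN -opprB opprK addrC -mulNr opprB. Qed.

Lemma ccosB2pi z : ccos (2 * (z - pi%:C)) = ccos (2 * z).
Proof. by rewrite /ccos !cexpN !cexp_mul2 cexpBpi sqrrN. Qed.

Lemma theta1Bpi tau z : theta1 tau (z - pi%:C) = - theta1 tau z.
Proof.
rewrite !theta1E csinBpi mulrN mulNr.
suff -> : theta_factor tau (z - pi%:C) = theta_factor tau z by [].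
by apply/funext => n; rewrite /theta_factor ccosB2pi.
Qed.

Lemma theta1_real_neq0 tau (t : R) : 0 < tau -> 0 < t < pi -> theta1 tau (- t%:C) != 0.
Proof.
move=> tau0 t_pi; apply/eqP => /(theta1_eq0 tau0) [k [_ _]].
by rewrite raddfN /= sinN => /eqP; rewrite oppr_eq0 gt_eqF // sin_gt0_pi.
Qed.

End Theta.

(** * Identities outside a discrete set *)

Section Generic.
Variable R : realType.
Implicit Types (A B : R[i] -> Prop) (z : R[i]).

(** The quantifier behind [mero_eq]: A may fail only on a closed discrete set. It is stable under
    finite conjunctions and affine substitutions. *)
Definition generically A := forall z, \forall x \near z^', A x.

Lemma generically_imp A B : (forall x, A x -> B x) -> generically A -> generically B.
Proof. by move=> AB gA z; move: (gA z); apply: filterS. Qed.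

Lemma generically_and A B : generically A -> generically B -> generically (fun x => A x /\ B x).
Proof. by move=> gA gB z; apply: filterI; [exact: gA | exact: gB]. Qed.

Lemma generically_all (I : eqType) (s : seq I) (A : I -> R[i] -> Prop) :
  (forall i, generically (A i)) -> generically (fun x => forall i, i \in s -> A i x).
Proof.
move=> gA; elim: s => [|i s IH]; first by move=> z; apply: nearW.
apply: generically_imp (generically_and (gA i) IH) => x [Ai As] j.
by rewrite inE => /predU1P[->|]; [|exact: As].
Qed.

Lemma generically_affine a b A : a != 0 -> generically A -> generically (fun x => A (a * x + b)).
Proof.
move=> a0 gA z; have /near_dnbhsP [e e0 He] := gA (a * z + b).
have na0 : 0 < nrm a by rewrite lt_neqAle nrm_ge0 eq_sym nrm_eq0 a0.
apply/near_dnbhsP; exists (e / nrm a); first by rewrite divr_gt0.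
move=> x; rewrite ltr_pdivlMr // => xz x_neq; apply: He.
  by rewrite (_ : _ - _ = a * (x - z)) ?nrmM 1?mulrC //; ring.
by apply: contraNneq x_neq => /addIr /(mulfI a0) ->.
Qed.

Lemma generically_theta1_neq0 (tau : R) : 0 < tau -> generically (fun x => theta1 tau x != 0).
Proof.
move=> tau0 z; have d0 : 0 < Num.min tau 1 / 2 by rewrite divr_gt0 // lt_min tau0 ltr01.
apply/near_dnbhsP.
have [[x0 [x0z x0d x00]]|H] := pselect (exists x0,
  [/\ x0 != z, nrm (x0 - z) < Num.min tau 1 / 2 & theta1 tau x0 = 0]).
  exists (nrm (x0 - z)); first by rewrite lt_neqAle nrm_ge0 eq_sym nrm_eq0 subr_eq0 x0z.
  move=> x xz _; apply/eqP => x_0.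
  have E : x = x0.
    apply: theta1_zeros_separated tau0 x_0 x00 _.
    have -> : x - x0 = (x - z) + (z - x0) by ring.
    apply: le_lt_trans (nrmD _ _) _; rewrite [ltRHS]splitr ltrD ?(lt_trans xz) //.
    have -> // : nrm (z - x0) = nrm (x0 - z) by rewrite /nrm distrC.
  by rewrite E ltxx in xz.
exists (Num.min tau 1 / 2) => // x xd xz; apply/eqP => x_0; apply: H.
by exists x.
Qed.

End Generic.

(** * Period and generic nonvanishing of phi and Q *)

Section Periods.
Variables (R : realType) (M : dilute) (tau u : R) (N : nat) (xs : 'I_N -> R[i]).
Hypothesis tau0 : 0 < tau.
Hypothesis Neven : ~~ odd N.
Local Notation L := (level M).
Local Notation h := (h M tau).
Local Notation phi := (phi M tau u N).
Local Notation Q := (Q M tau xs).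
Local Notation T := (T M tau u xs).

Definition period : R[i] := (pi / Defs.eta R M)%:C * Ci.

Lemma eta_gt0 : 0 < Defs.eta R M.
Proof. by rewrite /Defs.eta divr_gt0 ?mulr_gt0 ?pi_gt0 ?ltr0n ?addn_gt0 ?orbT. Qed.

Lemma hD_period x : h (x + period) = - h x.
Proof.
rewrite -theta1Bpi /h mulrDr; congr (theta1 tau (_ + _)).
have -> : Ci * (Defs.eta R M)%:C * period = (Ci * Ci)
  * ((Defs.eta R M)%:C * (pi / Defs.eta R M)%:C) by rewrite /period; ring.
by rewrite -expr2 sqr_i mulN1r -rmorphM /= mulrC divfK // gt_eqF // eta_gt0.
Qed.

Lemma generically_h_neq0 : generically (fun x => h x != 0).
Proof.
have a0 : Ci * (Defs.eta R M)%:C != 0.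
  rewrite mulf_neq0 //; first by rewrite eq_complex /= oner_eq0 andbF.
  by rewrite -(rmorph0 (real_complex R)) (inj_eq (@complexI _)) gt_eqF // eta_gt0.
apply: generically_imp (generically_affine 0 a0 (generically_theta1_neq0 tau0)) => x.
by rewrite addr0.
Qed.

(** It makes the normalisation h[2i] h[3i] of phi nonzero; it holds because 3 eta < pi, as 3 eta is
    9 pi/10 or 6 pi/7. *)
Lemma h_int_neq0 (n : nat) : (0 < n <= 3)%N -> h (n%:R * Ci) != 0.
Proof.
move=> n3; rewrite /h.
have -> : Ci * (Defs.eta R M)%:C * (n%:R * Ci) = - (Defs.eta R M * n%:R)%:C.
  have -> : Ci * (Defs.eta R M)%:C * (n%:R * Ci) = (Ci * Ci) * ((Defs.eta R M)%:C * n%:R) by ring.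
  by rewrite -expr2 sqr_i mulN1r -(rmorph_nat (real_complex R)) -rmorphM.
apply: theta1_real_neq0 => //; case/andP: n3 => n0 n3.
rewrite mulr_gt0 ?eta_gt0 ?ltr0n //=.
apply: (@le_lt_trans _ _ (Defs.eta R M * 3));
  first by rewrite ler_wpM2l ?ler_nat // ltW // eta_gt0.
have := pi_gt0 R; rewrite /Defs.eta; case: M => /=.
  rewrite -[(4 + 2)%N]/6%N -[(4 + 1)%N]/5%N; lra.
rewrite -[(6 + 2)%N]/8%N -[(6 + 1)%N]/7%N; lra.
Qed.

Lemma phiD_period x : phi (x + period) = phi x.
Proof.
by rewrite /phi addrAC hD_period (addrAC x) hD_period mulrNN.
Qed.

Lemma QD_period x : Q (x + period) = Q x.
Proof.
rewrite /Q; under eq_bigr => j _ do rewrite addrAC hD_period -mulN1r.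
rewrite big_split /= prodr_const card_ord -signr_odd (negbTE Neven) mul1r //.
Qed.

Lemma generically_shift c A : generically A -> generically (fun x : R[i] => A (x + c)).
Proof.
move=> gA; apply: generically_imp (generically_affine c (oner_neq0 _) gA) => x.
by rewrite mul1r.
Qed.

Lemma generically_phi_neq0 : generically (fun x => phi x != 0).
Proof.
pose a := (3 / 2 - u%:C) * Ci.
apply: generically_imp (generically_and (generically_shift a generically_h_neq0)
  (generically_shift (- a) generically_h_neq0)) => x [h1 h2].
by rewrite /phi expf_neq0 // mulf_neq0 ?invr_neq0 // mulf_neq0 // h_int_neq0.
Qed.

Lemma generically_Q_neq0 : generically (fun x => Q x != 0).
Proof.
have := @generically_all R _ (enum 'I_N) (fun j x => h (x - xs j) != 0)
   (fun j => generically_shift (- xs j) generically_h_neq0).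
apply: generically_imp => x H; rewrite /Q; apply/prodf_neq0 => j _.
by rewrite H ?mem_enum.
Qed.

Lemma T_periodic p : (forall x, phi (x + p) = phi x) -> (forall x, Q (x + p) = Q x) ->
  forall m x, T m (x + p) = T m x.
Proof.
move=> phi_p Q_p.
have box_p i x : box M tau u xs i (x + p) = box M tau u xs i x.
  by case: i => -[|[|[|//]]] ?; rewrite /box /= /box1 /box2 /box3 !(addrAC x p) !phi_p !Q_p.
case=> [[|m]|m] x //=; first by rewrite /pm !(addrAC x p) !phi_p.
rewrite /one_row; congr (_^-1 * _).
  by apply: eq_bigr => j _; rewrite /pm !(addrAC x p) !phi_p.
by apply: eq_bigr => t _; apply: eq_bigr => k _; rewrite addrAC box_p.
Qed.

End Periods.

(** * The transfer matrix eigenvalues along a chain *)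

Section BoxAlgebra.
Variables (F : fieldType) (v a b r1 r2 r3 r4 e : F).
Hypotheses (v0 : v != 0) (e0 : e != 0) (r10 : r1 != 0) (r20 : r2 != 0).

(** Here and in the next two lemmas e stands for v^(2k): the power of w in each box is cancelled by
    the rescaling of Q. *)
Lemma box_algebra1 : v * v * a * b * (e * r3 / (v * (v * e) * r1)) = a * b * (r3 / r1).
Proof. by field; rewrite v0 e0 r10. Qed.

Lemma box_algebra2 : a * b * (v * e * r3 * (v * (v * (v * (v * e))) * r4) /
  (v * (v * e) * r1 * (v * (v * (v * e)) * r2))) = a * b * (r3 * r4 / (r1 * r2)).
Proof. by field; rewrite v0 e0 r10 r20. Qed.

Lemma box_algebra3 : (v * v)^-1 * a * b
  * (v * (v * (v * (v * (v * e)))) * r3 / (v * (v * (v * e)) * r1)) =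
  a * b * (r3 / r1).
Proof. by field; rewrite v0 e0 r10. Qed.
End BoxAlgebra.

(** The normalisation f_m of the row pairs the chain points 3, ..., 2m symmetrically about m + 3/2;
    the points 1 and 2 are missing, which matches the factor [ph 1 * ph 2] of
    [tuple_sum_lattice]. *)
Lemma prod_fold (F : comRingType) (ph : nat -> F) m : (0 < m)%N ->
  (\prod_(1 <= j < m) (ph (m.*2.+1 - j)%N * ph (j + 2)%N)) * (ph 1 * ph 2)
    = \prod_(i < m.*2) ph i.+1.
Proof.
move=> m0; rewrite -(addnn m) big_split /= -[RHS](big_mkord xpredT (fun i => ph i.+1)).
rewrite -(big_add1 _ _ 0 (m + m).+1 xpredT ph) [in RHS](big_cat_nat (n := 3)) //=; last by lia.
rewrite [X in _ = _ * X](big_cat_nat (n := m + 2)) //=; [|by lia|by lia].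
have -> : \prod_(1 <= i < 3) ph i = ph 1 * ph 2 by rewrite big_ltn // big_nat1.
rewrite mulrC; congr (_ * _); rewrite mulrC; congr (_ * _).
  by rewrite -[3%N]/(1 + 2)%N big_addn addnK.
rewrite big_nat_rev /= [RHS](_ : _ = \prod_(1 + m.+1 <= i < m + m.+1) ph i); last first.
  by congr (\prod_(_ <= i < _) _); lia.
rewrite big_addn addnK big_nat [RHS]big_nat; apply: eq_bigr => j /andP[j1 jm].
by congr ph; lia.
Qed.

Section RowClosedForm.
Variables (R : realType) (M : dilute) (tau u : R) (N : nat) (xs : 'I_N -> R[i]).
Local Notation phi := (phi M tau u N).
Local Notation Q := (Q M tau xs).
Local Notation T := (T M tau u xs).
Local Notation L := (level M).

Definition sqrt_w : R[i] := cexp (Ci * (pi / (2 * (L + 1)%:R))%:C).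

Lemma sqrt_w2 : sqrt_w ^+ 2 = w R M.
Proof.
rewrite /sqrt_w /w -cexpX; congr cexp; rewrite -mulrnAr; congr (_ * _).
rewrite -[LHS](rmorphMn (real_complex R)) /=; congr (_%:C).
by rewrite -mulr_natl; field; rewrite natr1 pnatr_eq0.
Qed.

Lemma sqrt_w_anti : sqrt_w ^+ (L + 1).*2 = -1.
Proof.
rewrite -muln2 mulnC exprM sqrt_w2 /w -cexpX -[RHS]cexp_pi; congr cexp; rewrite -mulrnAr;
  congr (_ * _).
rewrite -[LHS](rmorphMn (real_complex R)) /=; congr (_%:C).
by rewrite -mulr_natl mulrC divfK ?pnatr_eq0 ?addn1.
Qed.

Lemma one_row_closed (p : R[i]) (ph Rs : nat -> R[i]) (m : nat) :
  (forall k, phi (p + k%:R * Ci) = ph k) -> (forall k, Q (p + k%:R * Ci) = sqrt_w ^+ k * Rs k) ->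
  (forall k, ph k != 0) -> (forall k, Rs k != 0) -> (0 < m)%N ->
  T m (p + (m%:R + 3 / 2) * Ci) = Rs 0 * Rs m.*2.+3 *
    \sum_(b < m.+1) (\sum_(a < b.+1) link ph Rs a.*2) * link ph Rs b.*2.+1.
Proof.
move=> phE QE ph0 Rs0 m0; set x := p + _.
have w0 : sqrt_w != 0 := cexp_neq0 _.
have [_ _ Tsum] := tuple_sum_lattice m ph0 Rs0.
have boxE (i : 'I_3) k : box M tau u xs i (p + (k.*2%:R + 5 / 2) * Ci) = lattice_box ph Rs i k.
  pose X := p + (k.*2%:R + 5 / 2) * Ci.
  have p3 : X + 3 / 2 * Ci = p + (k.*2.+4)%:R * Ci by rewrite /X -addn4 natrD; field.
  have p1 : X + 1 / 2 * Ci = p + (k.*2.+3)%:R * Ci by rewrite /X -addn3 natrD; field.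
  have n1 : X - 1 / 2 * Ci = p + (k.*2.+2)%:R * Ci by rewrite /X -addn2 natrD; field.
  have n3 : X - 3 / 2 * Ci = p + (k.*2.+1)%:R * Ci by rewrite /X -addn1 natrD; field.
  have p5 : X + 5 / 2 * Ci = p + (k.*2.+1.+4)%:R * Ci by rewrite /X -addn4 -addn1 !natrD; field.
  have n5 : X - 5 / 2 * Ci = p + (k.*2)%:R * Ci by rewrite /X; field.
  have wE : w R M = sqrt_w * sqrt_w by rewrite -sqrt_w2 expr2.
  rewrite -/X; case: i => -[|[|[|//]]] ?;
    rewrite /box /= /box1 /box2 /box3 ?p1 ?p3 ?p5 ?n1 ?n3 ?n5 !phE !QE ?wE.
  - by rewrite !exprS; apply: box_algebra1; rewrite ?expf_neq0.
  - by rewrite !exprS; apply: box_algebra2; rewrite ?expf_neq0.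
  - by rewrite !exprS; apply: box_algebra3; rewrite ?expf_neq0.
have sumE : \sum_(t : m.-tuple 'I_3 | sorted (fun a b : 'I_3 => (a <= b)%N) t)
    \prod_(k < m) box M tau u xs (tnth t k) (x + (2 * k.+1%:R - 1 - m%:R) * Ci) =
    tuple_sum 0 m (lattice_box ph Rs).
  apply: eq_big => [[s /= _]|t _]; first by case: s => //= i s; rewrite path_map.
  apply: eq_bigr => k _; rewrite -boxE; congr (box M tau u xs _ _).
  by rewrite /x -(muln2 k) natrM -(addn1 k) natrD; field.
have normE : row_norm M tau u N m x * (ph 1 * ph 2) = \prod_(i < m.*2) ph i.+1.
  rewrite /row_norm big_nat.
  under eq_bigr => j /andP[j1 jm].
    have -> : pm phi x ((2 * m%:R - 1) / 2 - j%:R) = ph (m.*2.+1 - j)%N * ph (j + 2)%N.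
      rewrite /pm; congr (_ * _); rewrite -phE; congr phi.
        rewrite natrB; last by rewrite -(muln2 m); lia.
        by rewrite /x -(addn1 m.*2) natrD -(muln2 m) natrM; field.
      by rewrite /x natrD; field.
  over.
  by rewrite -big_nat prod_fold.
have f0 : row_norm M tau u N m x != 0.
  have : \prod_(i < m.*2) ph i.+1 != 0 by apply/prodf_neq0.
  by rewrite -normE mulf_eq0 negb_or => /andP[].
have -> : T m x = (row_norm M tau u N m x)^-1 * tuple_sum 0 m (lattice_box ph Rs).
  by rewrite -sumE; case: (m) m0.
apply: (mulfI f0); rewrite mulVKf //; apply: (mulIf (ph0 1)); apply: (mulIf (ph0 2)).
by rewrite Tsum -normE; ring.
Qed.
End RowClosedForm.

(** * The two determinants Lambda of the A_4 model *)

Lemma det2 (F : comNzRingType) (A : 'M[F]_2) : \det A = A 0 0 * A 1 1 - A 0 1 * A 1 0.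
Proof.
rewrite (expand_det_row _ 0) !big_ord_recl big_ord0 /cofactor !det_mx11 !mxE /= addr0.
rewrite expr0 expr1 mul1r mulN1r mulrN.
by congr (A _ _ * A _ _ - A _ _ * A _ _); apply: val_inj.
Qed.

Lemma det3 (F : comNzRingType) (A : 'M[F]_3) : \det A =
  A 0 0 * (A 1 1 * A 2 2 - A 1 2 * A 2 1) - A 0 1 * (A 1 0 * A 2 2 - A 1 2 * A 2 0)
  + A 0 2 * (A 1 0 * A 2 1 - A 1 1 * A 2 0).
Proof.
rewrite (expand_det_row _ 0) !big_ord_recl big_ord0 /cofactor !det2 !mxE /= addr0.
rewrite expr0 expr1 mul1r mulN1r mulrN sqrrN expr1n mul1r -!addrA.
congr (A _ _ * (A _ _ * A _ _ - A _ _ * A _ _) + (- (A _ _ * (A _ _ * A _ _ - A _ _ * A _ _)) +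
  A _ _ * (A _ _ * A _ _ - A _ _ * A _ _))); exact: val_inj.
Qed.

Section LambdaValues.
Variables (R : realType) (tau u : R) (N : nat) (xs : 'I_N -> R[i]).
Local Notation T := (T A4 tau u xs).
Local Notation Lambda := (Lambda tau u xs).

Lemma Lambda_61 x : Lambda [:: 6; 1]%N [::] x =
  T 6 (x + Ci) * T 1 (x - 6 * Ci) - T 7 x * T 0 (x - 5 * Ci).
Proof.
rewrite /Lambda det2 !mxE.
transitivity (T 6 (x + 1%:~R * Ci) * T 1 (x + (-6)%:~R * Ci)
  - T 7 (x + 0%:~R * Ci) * T 0 (x + (-5)%:~R * Ci)).
  by [].
by rewrite mul1r mul0r addr0 !mulrNz !mulNr.
Qed.

(** The corner entries have index 13 and -1, outside the range of [Tflat], so the matrix is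
    tridiagonal. *)
Lemma Lambda_11_6_6 x : Lambda [:: 11; 6; 6]%N [:: 5; 5]%N x =
  T 6 (x + 7 * Ci) * (T 1 x * T 6 (x - 7 * Ci) - T 7 (x - 6 * Ci) * T 0 (x - Ci))
  - T 7 (x + 6 * Ci) * (T 0 (x + Ci) * T 6 (x - 7 * Ci)).
Proof.
rewrite /Lambda det3 !mxE.
transitivity (T 6 (x + 7%:~R * Ci) * (T 1 (x + 0%:~R * Ci) * T 6 (x + (-7)%:~R * Ci)
   - T 7 (x + (-6)%:~R * Ci) * T 0 (x + (-1)%:~R * Ci))
  - T 7 (x + 6%:~R * Ci) * (T 0 (x + 1%:~R * Ci) * T 6 (x + (-7)%:~R * Ci) -
       T 7 (x + (-6)%:~R * Ci) * 0)
  + 0 * (T 0 (x + 1%:~R * Ci) * T 0 (x + (-1)%:~R * Ci) - T 1 (x + 0%:~R * Ci) * 0)).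
  by [].
by rewrite mul1r mul0r !mulr0 subr0 addr0 mul0r addr0 !mulrNz !mulNr mul1r.
Qed.
End LambdaValues.

(** * Neighbours in the Dynkin diagrams *)

Lemma prod_E7_neighbours (F : comNzRingType) (G : nat -> F) a : (1 <= a <= 7)%N ->
  \prod_(1 <= b < 8 | adjacent A4 a b) G b = match a with
    | 1%N => G 2%N
    | 2%N => G 1%N * G 3%N
    | 3%N => G 2%N * G 4%N * G 7%N
    | 4%N => G 3%N * G 5%N
    | 5%N => G 4%N * G 6%N
    | 6%N => G 5%N
    | 7%N => G 3%N
    | _ => 0
    end.
Proof.
rewrite -big_filter; case: a => [//|[|[|[|[|[|[|[|//]]]]]]]] _.
- by rewrite -[seq.filter _ _]/[:: 2]%N !big_cons big_nil /= mulr1 ?mulrA.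
- by rewrite -[seq.filter _ _]/[:: 1; 3]%N !big_cons big_nil /= mulr1 ?mulrA.
- by rewrite -[seq.filter _ _]/[:: 2; 4; 7]%N !big_cons big_nil /= mulr1 ?mulrA.
- by rewrite -[seq.filter _ _]/[:: 3; 5]%N !big_cons big_nil /= mulr1 ?mulrA.
- by rewrite -[seq.filter _ _]/[:: 4; 6]%N !big_cons big_nil /= mulr1 ?mulrA.
- by rewrite -[seq.filter _ _]/[:: 5]%N !big_cons big_nil /= mulr1 ?mulrA.
- by rewrite -[seq.filter _ _]/[:: 3]%N !big_cons big_nil /= mulr1 ?mulrA.
Qed.

Lemma prod_E6_neighbours (F : comNzRingType) (G : nat -> F) a : (1 <= a <= 6)%N ->
  \prod_(1 <= b < 7 | adjacent A6 a b) G b = match a with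
    | 1%N => G 2%N
    | 2%N => G 1%N * G 3%N
    | 3%N => G 2%N * G 4%N * G 6%N
    | 4%N => G 3%N * G 5%N
    | 5%N => G 4%N
    | 6%N => G 3%N
    | _ => 0
    end.
Proof.
rewrite -big_filter; case: a => [//|[|[|[|[|[|[|//]]]]]]] _.
- by rewrite -[seq.filter _ _]/[:: 2]%N !big_cons big_nil /= mulr1 ?mulrA.
- by rewrite -[seq.filter _ _]/[:: 1; 3]%N !big_cons big_nil /= mulr1 ?mulrA.
- by rewrite -[seq.filter _ _]/[:: 2; 4; 6]%N !big_cons big_nil /= mulr1 ?mulrA.
- by rewrite -[seq.filter _ _]/[:: 3; 5]%N !big_cons big_nil /= mulr1 ?mulrA.
- by rewrite -[seq.filter _ _]/[:: 4]%N !big_cons big_nil /= mulr1 ?mulrA.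
- by rewrite -[seq.filter _ _]/[:: 3]%N !big_cons big_nil /= mulr1 ?mulrA.
Qed.

Lemma periodicZ (R : realType) (f : R[i] -> R[i]) p : (forall x, f (x + p) = f x) ->
  forall x (z : int), f (x + z%:~R * p) = f x.
Proof.
move=> fp x z.
have fn (n : nat) y : f (y + n%:R * p) = f y.
  elim: n => [|n IH]; first by rewrite mul0r addr0.
  by rewrite -natr1 mulrDl mul1r addrA fp.
case: z => n; first exact: fn.
by rewrite NegzE -[LHS](fn n.+1); congr f; rewrite mulrNz mulNr subrK.
Qed.

(** * The grid of step i/d *)

Section At.
Variables (R : realType) (d : nat).
Hypothesis d0 : (0 < d)%N.

(* Index arithmetic on the grid y + (i/d) Z; d = 6 for L = 4 and d = 4 for L = 6
   make all shifts of the T-system integral. *)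
Definition site (y : R[i]) (n : int) := y + n%:~R * (Ci / d%:R).

Let dC : d%:R != 0 :> R[i]. Proof. by rewrite pnatr_eq0 -lt0n. Qed.

Lemma siteD y n m c : c * d%:R = m%:~R -> site y n + c * Ci = site y (n + m).
Proof.
move=> cE; rewrite /site rmorphD /= mulrDl addrA -cE; congr (_ + _).
by rewrite -mulrA [d%:R * _]mulrC divfK.
Qed.

Lemma siteB y n m c : c * d%:R = m%:~R -> site y n - c * Ci = site y (n - m).
Proof. by move=> cE; rewrite -mulNr; apply: siteD; rewrite mulNr cE rmorphN. Qed.

Lemma siteD1 y n : site y n + Ci = site y (n + d%:Z).
Proof. by rewrite -[X in _ + X]mul1r; apply: siteD; rewrite mul1r. Qed.

Lemma siteB1 y n : site y n - Ci = site y (n - d%:Z).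
Proof. by rewrite -[X in _ - X]mul1r; apply: siteB; rewrite mul1r. Qed.

Lemma site_fracD y n (a b m : nat) : (0 < b)%N -> (a * d = m * b)%N ->
  site y n + a%:R / b%:R * Ci = site y (n + m%:R).
Proof.
move=> b0 ad; have bC : b%:R != 0 :> R[i] by rewrite pnatr_eq0 -lt0n.
by apply: siteD; apply: (mulIf bC); rewrite mulrAC divfK // rmorph_nat -!natrM ad.
Qed.

Lemma site_fracB y n (a b m : nat) : (0 < b)%N -> (a * d = m * b)%N ->
  site y n - a%:R / b%:R * Ci = site y (n - m%:R).
Proof.
move=> b0 ad; have bC : b%:R != 0 :> R[i] by rewrite pnatr_eq0 -lt0n.
by apply: siteB; apply: (mulIf bC); rewrite mulrAC divfK // rmorph_nat -!natrM ad.
Qed.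

Lemma generically_site c A : generically A -> generically (fun x : R[i] => A (site x c)).
Proof. exact: generically_shift. Qed.

Lemma site_scale x n : (x + n%:~R * Ci) / d%:R = site (x / d%:R) n.
Proof. by rewrite /site mulrDl mulrA. Qed.

(** A condition on all grid points is an infinite conjunction, to which genericity does not extend
    by itself; periodicity reduces it to P conditions. *)
Lemma generically_site_periodic (P : nat) (A : R[i] -> Prop) : (0 < P)%N ->
  (forall x z, A (site x (P%:Z * z)) <-> A x) -> generically A ->
  generically (fun x : R[i] => forall n, A (site x n)).
Proof.
move=> P0 Aper gA.
have := @generically_all R _ (iota 0 P) (fun n x => A (site x n%:Z)) (fun n =>
  generically_site n%:Z gA).
apply: generically_imp => x H n.
have -> : site x n = site (site x (n %% P)%Z) (P%:Z * (n %/ P)%Z).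
  rewrite /site -addrA -mulrDl -rmorphD /=; congr (_ + _%:~R * _).
  by rewrite [LHS](divz_eq n P) addrC mulrC.
apply/Aper; have r0 : (0 <= (n %% P)%Z) by rewrite modz_ge0 // -lt0n.
have : (n %% P)%Z < P by rewrite ltz_pmod.
case: (n %% P)%Z r0 => // k _ kP; apply: H.
by rewrite mem_iota.
Qed.
End At.

(** * The dilute A_4 model *)

Section DiluteA4.
Variables (R : realType) (tau u : R) (N : nat) (xs : 'I_N -> R[i]).
Hypothesis tau0 : 0 < tau.
Hypothesis Neven : ~~ odd N.
Hypothesis sector : largest_eigenvalue_sector A4 tau u xs.
Local Notation phi := (phi A4 tau u N).
Local Notation Q := (Q A4 tau xs).
Local Notation T := (T A4 tau u xs).
Local Notation at_ := (@site R 6).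
Local Notation v := (sqrt_w R A4).

Lemma period4 : period R A4 = 20%:~R * (Ci / 6).
Proof.
rewrite /period /Defs.eta /=.
have -> : pi / (pi * (4 + 2)%:R / (4 * (4 + 1)%:R)) = 20 / 6 :> R.
  rewrite -[(4 + 2)%N]/6%N -[(4 + 1)%N]/5%N.
  by move: (pi : R) (lt0r_neq0 (pi_gt0 R)) => p p0; field.
rewrite [X in X * _](fmorph_div (real_complex R)) !(rmorph_nat (real_complex R)).
by rewrite mulrAC mulrA.
Qed.

Let phi_at_per y n z : phi (at_ y (n + 20 * z)) = phi (at_ y n).
Proof.
rewrite -[RHS](periodicZ (@phiD_period R A4 tau u N) _ z) period4; congr phi.
by rewrite /site; ring.
Qed.

Let Q_at_per y n z : Q (at_ y (n + 20 * z)) = Q (at_ y n).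
Proof.
rewrite -[RHS](periodicZ (@QD_period R A4 tau N xs Neven) _ z) period4; congr Q.
by rewrite /site; ring.
Qed.

Let T_at_per m y n z : T m (at_ y (n + 20 * z)) = T m (at_ y n).
Proof.
rewrite -[RHS](periodicZ (T_periodic (@phiD_period R A4 tau u N)
  (@QD_period R A4 tau N xs Neven) m) _ z) period4.
by congr T; rewrite /site; ring.
Qed.

(** At such y the identities, known only between meromorphic functions, hold pointwise on the whole
    grid through y. *)
Definition regular4 y := (forall n, phi (at_ y n) != 0) /\ (forall n, Q (at_ y n) != 0) /\
  (forall n, T 9 (at_ y n) = 0) /\ (forall n, T 6 (at_ y n) = T 1 (at_ y n)) /\
  (forall n, T 7 (at_ y n) = T 0 (at_ y n)).

Lemma generically_regular4 : generically regular4.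
Proof.
have [_ Tsym [_ T9] _] := sector.
have at0 x z : at_ x (20 * z) = at_ x (0 + 20 * z) by rewrite add0r.
have x0 x : at_ x 0 = x by rewrite /site mul0r addr0.
have gen A : (forall x z, A (at_ x (20 * z)) <-> A x) -> generically A ->
    generically (fun x => forall n, A (at_ x n)) by exact: generically_site_periodic.
apply: generically_and; [|apply: generically_and;
  [|apply: generically_and; [|apply: generically_and]]].
- apply: (gen (fun x => phi x != 0)) => [x z|]; last exact: generically_phi_neq0.
  by rewrite at0 phi_at_per x0.
- apply: (gen (fun x => Q x != 0)) => [x z|]; last exact: generically_Q_neq0.
  by rewrite at0 Q_at_per x0.
- apply: (gen (fun x => T 9 x = 0)) => [x z|]; last exact: T9.
  by rewrite at0 T_at_per x0.
- apply: (gen (fun x => T 6 x = T 1 x)) => [x z|].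
    by rewrite at0 !T_at_per x0.
  by apply: generically_imp (Tsym 1 isT) => x ->.
- apply: (gen (fun x => T 7 x = T 0 x)) => [x z|].
    by rewrite at0 !T_at_per x0.
  by apply: generically_imp (Tsym 0 isT) => x ->.
Qed.

Section Regular.
Variable y : R[i].
Hypothesis y_reg : regular4 y.

Let f n := phi (at_ y n).
Let q n := Q (at_ y n).
Let Tr (m : nat) n := T m (at_ y n).

Let f_neq0 n : f n != 0. Proof. by case: y_reg => [A [B [C [D E]]]]; apply: A. Qed.
Let q_neq0 n : q n != 0. Proof. by case: y_reg => [A [B [C [D E]]]]; apply: B. Qed.
Let Tr9 n : Tr 9 n = 0. Proof. by case: y_reg => [A [B [C [D E]]]]; apply: C. Qed.
Let Tr6 n : Tr 6 n = Tr 1 n. Proof. by case: y_reg => [A [B [C [D E]]]]; apply: D. Qed.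
Let Tr7 n : Tr 7 n = Tr 0 n. Proof. by case: y_reg => [A [B [C [D E]]]]; apply: E. Qed.
Let two0 : 2 != 0 :> R[i]. Proof. by rewrite pnatr_eq0. Qed.
Let v0 : v != 0. Proof. exact: cexp_neq0. Qed.
Let v10 : v ^+ 10 = -1. Proof. exact: (sqrt_w_anti R A4). Qed.

Let Tr_closed c m : (0 < m)%N -> Tr m (c + 3 * (2 * m%:Z + 3)) =
  chain_Q 3 v q c 0 * chain_Q 3 v q c m.*2.+3
  * \sum_(b < m.+1) (\sum_(a < b.+1) chain_link 3 v f q c a.*2) * chain_link 3 v f q c b.*2.+1.
Proof.
move=> m0.
have atk k : at_ y c + k%:R * Ci = at_ y (c + 2 * 3 * k%:Z).
  by apply: siteD; rewrite // intrM mulrC.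
have phE k : phi (at_ y c + k%:R * Ci) = chain_phi 3 f c k by rewrite atk.
have QE k : Q (at_ y c + k%:R * Ci) = v ^+ k * chain_Q 3 v q c k.
  by rewrite atk /chain_Q mulVKf ?expf_neq0.
have R0 k : chain_Q 3 v q c k != 0 by rewrite chain_Q_neq0.
have f0 k : chain_phi 3 f c k != 0 by exact: f_neq0.
rewrite -(one_row_closed phE QE f0 R0 m0); congr T; apply/esym/siteD => //.
by rewrite !(rmorphM, rmorphD) /=; field.
Qed.

Let sq2E : ((Num.sqrt 2 : R)%:C) ^+ 2 = 2 :> R[i].
Proof.
by rewrite -rmorphXn sqr_sqrtr // (rmorph_nat (real_complex R)).
Qed.

Let kap : R[i] := (Num.sqrt 2)%:C * v ^+ 5.
Let spin := spinor4 v (Num.sqrt 2)%:C f q.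
Let T5s n := Tr 2 (n + 10).

Let lat4 c : E7.lattice kap f (Tr 1) T5s spin c :=
  E7_lattice two0 v0 v10 sq2E (phi_at_per y) (Q_at_per y) q_neq0
    (fun m => T_at_per m y) Tr_closed Tr9 c.

Let kap2 : kap ^+ 2 = - 2.
Proof. by rewrite /kap exprMn sq2E -exprM v10 mulrN1. Qed.

Let atp n a b m (b0 : (0 < b)%N) (e : (a * 6 = m * b)%N) := @site_fracD R 6 isT y n a b m b0 e.
Let atm n a b m (b0 : (0 < b)%N) (e : (a * 6 = m * b)%N) := @site_fracB R 6 isT y n a b m b0 e.

Let T0E n : T 0 (at_ y n) = E7.T0 f n.
Proof.
by rewrite [LHS]/(pm phi (at_ y n) (1 / 2)) /pm (@atp n 1 2 3 isT erefl) (@atm n 1 2 3 isT erefl).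
Qed.

Let pmE n a b m : (0 < b)%N -> (a * 6 = m * b)%N ->
  pm (T 0) (at_ y n) (a%:R / b%:R) = E7.T0 f (n + m%:R) * E7.T0 f (n - m%:R).
Proof. by move=> b0 e; rewrite /pm (atp n b0 e) (atm n b0 e) !T0E. Qed.

Let p1 n : at_ y n + Ci = at_ y (n + 6%:R) := @siteD1 R 6 isT y n.
Let m1 n : at_ y n - Ci = at_ y (n - 6%:R) := @siteB1 R 6 isT y n.

Let T6E n : T4_6 tau u xs (at_ y n) = spin n.
Proof.
rewrite /T4_6 -!sqrt_w2.
rewrite !(@atp n 2 3 4 isT erefl).
rewrite !(@atp n 1 3 2 isT erefl).
rewrite !(@atp n 4 3 8 isT erefl).
rewrite !(@atp n 5 3 10 isT erefl).
rewrite !(@atm n 2 3 4 isT erefl).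
rewrite !(@atm n 1 3 2 isT erefl).
rewrite !(@atm n 4 3 8 isT erefl).
rewrite !(@atm n 5 3 10 isT erefl).
rewrite (p1 n) (m1 n).
by [].
Qed.

Let T5E n : T4_5 tau u xs (at_ y n) = T5s n.
Proof. by rewrite /T4_5 (@atp n 5 3 10 isT erefl). Qed.

Let T4E n : T4_4 tau u xs (at_ y n) = E7.T4 f T5s spin n.
Proof.
rewrite /T4_4 !(@atp n 2 3 4 isT erefl) !(@atp n 1 3 2 isT erefl) !(@atm n 1 3 2 isT erefl).
by rewrite !(@atm n 1 6 1 isT erefl) T5E !T6E.
Qed.

Let T7E n : T4_7 tau u xs (at_ y n) = E7.T7 f (Tr 1) spin n.
Proof.
rewrite /T4_7 (@atp n 1 2 3 isT erefl) (@atp n 4 3 8 isT erefl) (@atm n 2 3 4 isT erefl).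
by rewrite (@atm n 4 3 8 isT erefl) m1 !T6E mulrC.
Qed.

Let f_shift z n m : n = m + 20 * z -> f n = f m.
Proof. by move=> ->; exact: phi_at_per. Qed.
Let Tr_shift k z n m : n = m + 20 * z -> Tr k n = Tr k m.
Proof. by move=> ->; exact: T_at_per. Qed.
Let T0_shift z n m : n = m + 20 * z -> E7.T0 f n = E7.T0 f m.
Proof. by move=> ->; rewrite /E7.T0; congr (_ * _); apply: (f_shift (z := z)); ring. Qed.

Let atnD n (c : nat) : at_ y n + c%:R * Ci = at_ y (n + (c * 6)%N%:Z).
Proof. by apply: siteD; rewrite // -natrM. Qed.
Let atnB n (c : nat) : at_ y n - c%:R * Ci = at_ y (n - (c * 6)%N%:Z).
Proof. by apply: siteB; rewrite // -natrM. Qed.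

Let T2E n : T4_2 tau u xs (at_ y n) = E7.T2 f (Tr 1) n.
Proof.
rewrite /T4_2 Lambda_61 (@atm n 5 3 10 isT erefl) (@atm n 5 6 5 isT erefl) p1 !atnB mulrC.
rewrite T0E -[T 6 _]/(Tr 6 _) Tr6 -[T 7 _]/(Tr 7 _) Tr7 -[Tr 0 _]/(T 0 _) T0E -[T 1 _]/(Tr 1 _).
rewrite /E7.T2 -[phi _]/(f _) (@f_shift (-1) (n - 10) (n + 10)); last by ring.
rewrite (_ : n - 5 + 6 = n + 1); last by ring.
rewrite (@Tr_shift 1 (-2) (n - 5 - (6 * 6)%N%:Z) (n - 1)); last by ring.
rewrite (@T0_shift (-2) (n - 5 - (5 * 6)%N%:Z) (n + 5)); last by ring.
by rewrite [E7.T0 f (n - 5) * _]mulrC.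
Qed.

(** Modulo the period of 20 points, the shifts by 7i and 6i (42 and 36 points) become 2 and -4. *)
Let T3E n : T4_3 tau u xs (at_ y n) = E7.T3 f (Tr 1) n.
Proof.
rewrite /T4_3 Lambda_11_6_6 /pm (@atp n 3 2 9 isT erefl) (@atm n 3 2 9 isT erefl) !atnB
  !atnD p1 m1 mulrC.
rewrite !T0E -![T 6 _]/(Tr 6 _) !Tr6 -![T 7 _]/(Tr 7 _) !Tr7 -![Tr 0 _]/(T 0 _)
  !T0E -![T 1 _]/(Tr 1 _).
rewrite /E7.T3 -![phi _]/(f _); congr (_ / _).
rewrite (@Tr_shift 1 2 (n + (7 * 6)%N%:Z) (n + 2)); last by ring.
rewrite (@Tr_shift 1 (-2) (n - (7 * 6)%N%:Z) (n - 2)); last by ring.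
rewrite (@T0_shift 2 (n + (6 * 6)%N%:Z) (n - 4)); last by ring.
rewrite (@T0_shift (-2) (n - (6 * 6)%N%:Z) (n + 4)); last by ring.
move: (Tr 1 (n + 2)) (Tr 1 n) (Tr 1 (n - 2)) (E7.T0 f _) (E7.T0 f _) (E7.T0 f _) (E7.T0 f _).
by move=> *; ring.
Qed.

Lemma Y4E a x n : x / 6 = at_ y n -> Y4 tau u xs a x = E7.Y f (Tr 1) T5s spin a n.
Proof.
set z := x / 6 => zE; case: a => [//|[|[|[|[|[|[|[|//]]]]]]]].
- by rewrite -[LHS]/(phi (z + 10 / 6 * Ci) * T4_2 tau u xs z / pm (T 0) z (5 / 6)) zE
    (@atp n 10 6 10 isT erefl) T2E (@pmE n 5 6 5 isT erefl).
- by rewrite -[LHS]/(T4_1 tau u xs z * T4_3 tau u xs z / (T 0 z * pm (T 0) z (4 / 6))) zE T3E T0E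
    (@pmE n 4 6 4 isT erefl).
- by rewrite -[LHS]/(T4_2 tau u xs z * T4_4 tau u xs z * T4_7 tau u xs z
    / (pm (T 0) z (1 / 6) * pm (T 0) z (1 / 2))) zE T2E T4E T7E (@pmE n 1 6 1 isT erefl)
    (@pmE n 1 2 3 isT erefl).
- by rewrite -[LHS]/(T4_3 tau u xs z * T4_5 tau u xs z
    / (T 0 z * pm (T 0) z (1 / 3))) zE T3E T5E T0E (@pmE n 1 3 2 isT erefl).
- by rewrite -[LHS]/(T4_4 tau u xs z * T4_6 tau u xs z / pm (T 0) z (1 / 6)) zE T4E T6E
    (@pmE n 1 6 1 isT erefl).
- by rewrite -[LHS]/(T4_5 tau u xs z / T 0 z) zE T5E T0E.
- by rewrite -[LHS]/(T4_3 tau u xs z / pm (T 0) z (1 / 3)) zE T3E (@pmE n 1 3 2 isT erefl).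
Qed.

Let f20 n : f (n + 20) = f n.
Proof. by apply: (f_shift (z := 1)); ring. Qed.

Lemma Y4_relation a x : (1 <= a <= 7)%N -> y = x / 6 ->
  Y4 tau u xs a (x - Ci) * Y4 tau u xs a (x + Ci) =
    \prod_(1 <= b < 8 | adjacent A4 a b) (1 + Y4 tau u xs b x).
Proof.
move=> a17 yE.
have xm : (x - Ci) / 6 = at_ y (0 - 1) by rewrite yE -site_scale rmorphB /= sub0r mulN1r.
have xp : (x + Ci) / 6 = at_ y (0 + 1) by rewrite yE -site_scale add0r mul1r.
have x0 : x / 6 = at_ y 0 by rewrite /site mul0r addr0.
rewrite (Y4E _ xm) (Y4E _ xp) (E7.Y_system kap2 f_neq0 lat4 f20 _ a17).
under eq_bigr => b _ do rewrite (Y4E _ x0).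
by rewrite prod_E7_neighbours //; case: a a17 => [|[|[|[|[|[|[|[|//]]]]]]]].
Qed.

End Regular.

End DiluteA4.

(** * The dilute A_6 model *)

Section DiluteA6.
Variables (R : realType) (tau u : R) (N : nat) (xs : 'I_N -> R[i]).
Hypothesis tau0 : 0 < tau.
Hypothesis Neven : ~~ odd N.
Hypothesis sector : largest_eigenvalue_sector A6 tau u xs.
Local Notation phi := (phi A6 tau u N).
Local Notation Q := (Q A6 tau xs).
Local Notation T := (T A6 tau u xs).
Local Notation at_ := (@site R 4).
Local Notation v := (sqrt_w R A6).

Lemma period6 : period R A6 = 14%:~R * (Ci / 4).
Proof.
rewrite /period /Defs.eta /=.
have -> : pi / (pi * (6 + 2)%:R / (4 * (6 + 1)%:R)) = 14 / 4 :> R.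
  rewrite -[(6 + 2)%N]/8%N -[(6 + 1)%N]/7%N.
  by move: (pi : R) (lt0r_neq0 (pi_gt0 R)) => p p0; field.
rewrite [X in X * _](fmorph_div (real_complex R)) !(rmorph_nat (real_complex R)).
by rewrite mulrAC mulrA.
Qed.

Let phi_at_per y n z : phi (at_ y (n + 14 * z)) = phi (at_ y n).
Proof.
rewrite -[RHS](periodicZ (@phiD_period R A6 tau u N) _ z) period6; congr phi.
by rewrite /site; ring.
Qed.

Let Q_at_per y n z : Q (at_ y (n + 14 * z)) = Q (at_ y n).
Proof.
rewrite -[RHS](periodicZ (@QD_period R A6 tau N xs Neven) _ z) period6; congr Q.
by rewrite /site; ring.
Qed.

Let T_at_per m y n z : T m (at_ y (n + 14 * z)) = T m (at_ y n).
Proof.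
rewrite -[RHS](periodicZ (T_periodic (@phiD_period R A6 tau u N)
  (@QD_period R A6 tau N xs Neven) m) _ z) period6.
by congr T; rewrite /site; ring.
Qed.

Definition regular6 y := (forall n, phi (at_ y n) != 0) /\ (forall n, Q (at_ y n) != 0) /\
  (forall n, T 13 (at_ y n) = 0).

Lemma generically_regular6 : generically regular6.
Proof.
have [_ _ [_ T13] _] := sector.
have at0 x z : at_ x (14 * z) = at_ x (0 + 14 * z) by rewrite add0r.
have x0 x : at_ x 0 = x by rewrite /site mul0r addr0.
have gen A : (forall x z, A (at_ x (14 * z)) <-> A x) -> generically A ->
    generically (fun x => forall n, A (at_ x n)) by exact: generically_site_periodic.
apply: generically_and; [|apply: generically_and].
- apply: (gen (fun x => phi x != 0)) => [x z|]; last exact: generically_phi_neq0.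
  by rewrite at0 phi_at_per x0.
- apply: (gen (fun x => Q x != 0)) => [x z|]; last exact: generically_Q_neq0.
  by rewrite at0 Q_at_per x0.
- apply: (gen (fun x => T 13 x = 0)) => [x z|]; last exact: T13.
  by rewrite at0 T_at_per x0.
Qed.

Section Regular.
Variable y : R[i].
Hypothesis y_reg : regular6 y.

Let f n := phi (at_ y n).
Let q n := Q (at_ y n).
Let Tr (m : nat) n := T m (at_ y n).

Let f_neq0 n : f n != 0. Proof. by case: y_reg => [A [B C]]; apply: A. Qed.
Let q_neq0 n : q n != 0. Proof. by case: y_reg => [A [B C]]; apply: B. Qed.
Let Tr13 n : Tr 13 n = 0. Proof. by case: y_reg => [A [B C]]; apply: C. Qed.
Let two0 : 2 != 0 :> R[i]. Proof. by rewrite pnatr_eq0. Qed.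
Let v0 : v != 0. Proof. exact: cexp_neq0. Qed.
Let v14 : v ^+ 14 = -1. Proof. exact: (sqrt_w_anti R A6). Qed.

Let Tr_closed c m : (0 < m)%N -> Tr m (c + 2 * (2 * m%:Z + 3)) =
  chain_Q 2 v q c 0 * chain_Q 2 v q c m.*2.+3
  * \sum_(b < m.+1) (\sum_(a < b.+1) chain_link 2 v f q c a.*2) * chain_link 2 v f q c b.*2.+1.
Proof.
move=> m0.
have atk k : at_ y c + k%:R * Ci = at_ y (c + 2 * 2 * k%:Z).
  by apply: siteD; rewrite // intrM mulrC.
have phE k : phi (at_ y c + k%:R * Ci) = chain_phi 2 f c k by rewrite atk.
have QE k : Q (at_ y c + k%:R * Ci) = v ^+ k * chain_Q 2 v q c k.
  by rewrite atk /chain_Q mulVKf ?expf_neq0.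
have R0 k : chain_Q 2 v q c k != 0 by rewrite chain_Q_neq0.
have f0 k : chain_phi 2 f c k != 0 by exact: f_neq0.
rewrite -(one_row_closed phE QE f0 R0 m0); congr T; apply/esym/siteD => //.
by rewrite !(rmorphM, rmorphD) /=; field.
Qed.

Let spin := spinor6 v f q.

Let lat6 c : E6.lattice f (Tr 1) spin c :=
  E6_lattice two0 v0 v14 (phi_at_per y) (Q_at_per y) q_neq0
    (fun m => T_at_per m y) Tr_closed Tr13 c.

Let atp n a b m (b0 : (0 < b)%N) (e : (a * 4 = m * b)%N) := @site_fracD R 4 isT y n a b m b0 e.
Let atm n a b m (b0 : (0 < b)%N) (e : (a * 4 = m * b)%N) := @site_fracB R 4 isT y n a b m b0 e.

Let T0E n : T 0 (at_ y n) = E6.T0 f n.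
Proof.
by rewrite [LHS]/(pm phi (at_ y n) (1 / 2)) /pm (@atp n 1 2 2 isT erefl) (@atm n 1 2 2 isT erefl).
Qed.

Let pmE n a b m : (0 < b)%N -> (a * 4 = m * b)%N ->
  pm (T 0) (at_ y n) (a%:R / b%:R) = E6.T0 f (n + m%:R) * E6.T0 f (n - m%:R).
Proof. by move=> b0 e; rewrite /pm (atp n b0 e) (atm n b0 e) !T0E. Qed.

Let T1E n : T6_1 tau u xs (at_ y n) = spin n.
Proof.
rewrite /T6_1 -!sqrt_w2.
rewrite !(@atp n 1 4 1 isT erefl) !(@atp n 3 4 3 isT erefl) !(@atp n 5 4 5 isT erefl).
rewrite !(@atp n 7 4 7 isT erefl) !(@atm n 1 4 1 isT erefl) !(@atm n 3 4 3 isT erefl).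
by rewrite !(@atm n 5 4 5 isT erefl) !(@atm n 7 4 7 isT erefl).
Qed.

Let T2E n : T6_2 tau u xs (at_ y n) = E6.T2 f spin n.
Proof.
by rewrite /T6_2 !(@atp n 1 4 1 isT erefl) !(@atm n 1 4 1 isT erefl) !T1E T0E.
Qed.

Let T3E n : T6_3 tau u xs (at_ y n) = E6.T3 f (Tr 1) n.
Proof.
rewrite /T6_3 !(@atp n 1 4 1 isT erefl) !(@atm n 1 4 1 isT erefl) (@atp n 7 4 7 isT erefl).
by rewrite (@pmE n 3 4 3 isT erefl) mulrC [E6.T0 f (n + _) * _]mulrC.
Qed.

Lemma Y6E a x n : x / 4 = at_ y n -> Y6 tau u xs a x = E6.Y f (Tr 1) spin a n.
Proof.
set z := x / 4 => zE; case: a => [//|[|[|[|[|[|[|//]]]]]]].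
- by rewrite -[LHS]/(T6_2 tau u xs z / T 0 z) zE T2E T0E.
- by rewrite -[LHS]/(T6_1 tau u xs z * T6_3 tau u xs z / pm (T 0) z (1 / 4)) zE T1E T3E
    (@pmE n 1 4 1 isT erefl).
- by rewrite -[LHS]/(T6_2 tau u xs z ^+ 2 * T6_6 tau u xs z
    / (T 0 z * pm (T 0) z (1 / 2))) zE T2E T0E (@pmE n 1 2 2 isT erefl).
- by rewrite -[LHS]/(T6_1 tau u xs z * T6_3 tau u xs z / pm (T 0) z (1 / 4)) zE T1E T3E
    (@pmE n 1 4 1 isT erefl).
- by rewrite -[LHS]/(T6_2 tau u xs z / T 0 z) zE T2E T0E.
- by rewrite -[LHS]/(phi (z + 7 / 4 * Ci) * T6_3 tau u xs z / pm (T 0) z (3 / 4)) zE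
    (@atp n 7 4 7 isT erefl) T3E (@pmE n 3 4 3 isT erefl).
Qed.

Let f14 n : f (n + 14) = f n.
Proof. by rewrite -[RHS](phi_at_per y n 1) mulr1. Qed.

Lemma Y6_relation a x : (1 <= a <= 6)%N -> y = x / 4 ->
  Y6 tau u xs a (x - Ci) * Y6 tau u xs a (x + Ci) =
    \prod_(1 <= b < 7 | adjacent A6 a b) (1 + Y6 tau u xs b x).
Proof.
move=> a16 yE.
have xm : (x - Ci) / 4 = at_ y (0 - 1) by rewrite yE -site_scale rmorphB /= sub0r mulN1r.
have xp : (x + Ci) / 4 = at_ y (0 + 1) by rewrite yE -site_scale add0r mul1r.
have x0 : x / 4 = at_ y 0 by rewrite /site mul0r addr0.
rewrite (Y6E _ xm) (Y6E _ xp) (E6.Y_system f_neq0 lat6 f14 _ a16).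
under eq_bigr => b _ do rewrite (Y6E _ x0).
by rewrite prod_E6_neighbours //; case: a a16 => [|[|[|[|[|[|[|//]]]]]]] // _; rewrite mulrC.
Qed.

End Regular.

End DiluteA6.

Theorem theorem2 (R : realType) (M : dilute) (tau u : R) (N : nat)
    (xs : 'I_N -> R[i])
    (htau : 0 < tau) (hN0 : (0 < N)%N) (hNeven : ~~ odd N)
    (hbethe : bethe_equations M tau u xs)
    (hsector : largest_eigenvalue_sector M tau u xs)
    (a : nat) (ha : (1 <= a <= rank M)%N) :
  (fun x => Y M tau u xs a (x - Ci) * Y M tau u xs a (x + Ci))
  =m
  (fun x => \prod_(1 <= b < (rank M).+1 | adjacent M a b)
              (1 + Y M tau u xs b x)).
Proof.
(* Y is evaluated at y = x/6 or x/4, so regularity has to be generic in x, and a shift of x by i is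
   one grid step of y. *)
have scale d (A : R[i] -> Prop) : (0 < d)%N -> generically A ->
  generically (fun x => A (x / d%:R)).
  move=> d0 gA; have d1 : d%:R^-1 != 0 :> R[i] by rewrite invr_neq0 // pnatr_eq0 -lt0n.
  by apply: generically_imp (generically_affine 0 d1 gA) => x; rewrite addr0 mulrC.
case: M hbethe hsector ha => _ hsector ha.
- apply: generically_imp (scale 6%N _ isT (generically_regular4 htau hNeven hsector)) => x y_reg.
  exact: (Y4_relation hNeven y_reg ha erefl).
- apply: generically_imp (scale 4%N _ isT (generically_regular6 htau hNeven hsector)) => x y_reg.
  exact: (Y6_relation hNeven y_reg ha erefl).
Qed.
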